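(* Let $p$ be a prime integer, let $R=\mathbb Z[X,Y]$ be the polynomial ring in two variables over $\mathbb Z$, and consider the ramified regular local ring $T=(R/(XY-p))_{(X,Y)}$. For an ideal $J$ of $T$, let $I=J\cap R$, and for an integer $i\geq 0$ assume that $p\notin \operatorname{Ass}_{\mathbb Z} H^{i}_I(R) \cup \operatorname{Ass}_{\mathbb Z} H^{i+1}_{I}(R)$. Then the Bockstein homomorphism $\beta^{i-1}_{p,IT}: H^{i-1}_{IT}(T/pT)\rightarrow H^{i}_{IT}(T/pT)$ is zero.
   Context: $J\cap R$ denotes the inverse image of $J$ under the natural ring map $R\to T$, and $IT$ is the extension of $I$ to $T$. $H^i_I(-)$ denotes the $i$-th local cohomology with support in $I$ (zero for negative $i$). For a prime integer $p$ and an abelian group $M$, ''$p\notin\operatorname{Ass}_{\mathbb Z}M$'' means that $p\mathbb Z$ is not an associated prime of $M$ as a $\mathbb Z$-module (equivalently, multiplication by $p$ on $M$ is injective). A local ring with maximal ideal $\mathfrak m$, of mixed characteristic with residue characteristic $p$, is ramified if $p\in\mathfrak m^2$. Bockstein homomorphism: for a Noetherian ring $A$, an ideal $J\subset A$ and a nonzerodivisor $u\in A$, the short exact sequence $0\to A\xrightarrow{u}A\to A/uA\to 0$ induces a long exact sequence $$\cdots\to H^{i-1}_{J}(A/uA)\xrightarrow{\delta^{i-1}_{u,J}} H^{i}_{J}(A)\xrightarrow{u}H^{i}_{J}(A)\xrightarrow{\pi^i_{u,J}} H^{i}_{J}(A/uA) \to\cdots,$$ and $\beta^{i-1}_{u,J}:=\pi^i_{u,J}\circ\delta^{i-1}_{u,J}: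 H^{i-1}_J(A/uA)\to H^i_J(A/uA)$. Here $A=T$, $u=p$, with support ideal $IT$. *)

(* Defs.v *)
From HB Require Import structures.
From mathcomp Require Import all_boot all_algebra.
From mathcomp Require Import generic_quotient ring_quotient.
From mathcomp Require Import boolp classical_sets.
From mathcomp Require Import ring.

Set Implicit Arguments.
Unset Strict Implicit.
Unset Printing Implicit Defensive.

Import GRing.Theory.

Local Open Scope classical_set_scope.
Local Open Scope ring_scope.
Local Open Scope quotient_scope.

Section Ideals.
Variable A : comNzRingType.
Implicit Types I J S : set A.

(* Unlike [idealr_closed] of the library, the unit ideal is allowed. *)
Definition is_ideal J : Prop :=
  [/\ J 0, forall x y, J x -> J y -> J (x + y)
    & forall a x, J x -> J (a * x)].

Definition ideal_span S : set A :=
  [set x | forall J, is_ideal J -> S `<=` J -> J x].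

Definition ideal_mul I J : set A :=
  ideal_span [set z | exists x y, [/\ I x, J y & z = x * y]].

Definition ideal_exp I n : set A := iter n (ideal_mul I) setT.

Lemma ideal_spanP S : is_ideal (ideal_span S).
Proof.
split=> [J []//|x y Sx Sy J JI SJ|a x Sx J JI SJ]; have [_ JD JM] := JI.
  exact: JD (Sx _ JI SJ) (Sy _ JI SJ).
exact: JM (Sx _ JI SJ).
Qed.

Lemma sub_ideal_span S : S `<=` ideal_span S.
Proof. by move=> x Sx J _; apply. Qed.

Lemma ideal_expP I n : is_ideal (ideal_exp I n).
Proof. by case: n => [|n]; [split | exact: ideal_spanP]. Qed.

Lemma ideal_exp_decr I m n : (m <= n)%N -> ideal_exp I n `<=` ideal_exp I m.
Proof.
move=> /subnK <-; elim: (n - m)%N => // k IHk x xI; apply: IHk.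
apply: (xI _ (ideal_expP I (k + m))) => _ [a [b [_ bI ->]]].
by have [_ _ IM] := ideal_expP I (k + m); apply: IM.
Qed.

End Ideals.

Module Localization.
Section Localization.
Variables (A : comNzRingType) (P : prime_idealr A).

Notation denom := {s : A | s \notin P}.
Notation frac := (A * denom)%type.
Local Notation n_ x := (x : frac).1.
Local Notation d_ x := (sval (x : frac).2).

Lemma denom1_subproof : 1 \notin P.
Proof. by rewrite idealr1. Qed.
Definition denom1 : denom := exist (fun s => s \notin P) 1 denom1_subproof.

Lemma denomM_subproof (s t : denom) : sval s * sval t \notin P.
Proof. by rewrite prime_idealrM negb_or (svalP s) (svalP t). Qed.
Definition denomM (s t : denom) : denom :=
  exist (fun s => s \notin P) _ (denomM_subproof s t).

Definition equivl (x y : frac) : bool :=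
  `[< exists u : denom, sval u * (n_ x * d_ y - n_ y * d_ x) = 0 >].

Lemma equivl_refl : reflexive equivl.
Proof. by move=> x; apply/asboolP; exists denom1; rewrite subrr mulr0. Qed.

Lemma equivl_sym : symmetric equivl.
Proof.
suff H x y : equivl x y -> equivl y x by move=> x y; apply/idP/idP; apply: H.
move=> /asboolP[u hu]; apply/asboolP; exists u.
by rewrite -[_ - _]opprB mulrN hu oppr0.
Qed.

Lemma equivl_trans : transitive equivl.
Proof.
move=> y x z /asboolP[u hu] /asboolP[v hv]; apply/asboolP.
exists (denomM (denomM u v) y.2).
transitivity (sval v * d_ z * (sval u * (n_ x * d_ y - n_ y * d_ x))
            + sval u * d_ x * (sval v * (n_ y * d_ z - n_ z * d_ y))).
  by rewrite /=; ring.
by rewrite hu hv !mulr0 addr0.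
Qed.

Canonical equivl_equiv :=
  EquivRel equivl equivl_refl equivl_sym equivl_trans.
Canonical equivl_encModRel := defaultEncModRel equivl.

Definition type := {eq_quot equivl}.
#[export] HB.instance Definition _ : EqQuotient _ equivl type := EqQuotient.on type.
#[export] HB.instance Definition _ := Choice.on type.

Lemma equivlP (x y : frac) :
  reflect (exists u : denom, sval u * (n_ x * d_ y - n_ y * d_ x) = 0)
          (x == y %[mod type]).
Proof. by rewrite eqmodE; exact: asboolP. Qed.

Lemma equivl1 (x y : frac) : n_ x * d_ y = n_ y * d_ x -> x = y %[mod type].
Proof.
by move=> h; apply/eqP/equivlP; exists denom1; rewrite h subrr mulr0.
Qed.

Lemma repr_equivl (x : frac) : exists u : denom,
  sval u * (n_ (repr (\pi_type x)) * d_ x - n_ x * d_ (repr (\pi_type x))) = 0.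
Proof. by apply/equivlP; rewrite reprK. Qed.

Definition addf (x y : frac) : frac :=
  (n_ x * d_ y + n_ y * d_ x, denomM x.2 y.2).
Definition add := lift_op2 type addf.

Lemma pi_add : {morph \pi : x y / addf x y >-> add x y}.
Proof.
move=> x y; unlock add; apply/esym/eqP/equivlP.
have [u hu] := repr_equivl x; have [v hv] := repr_equivl y.
move: (repr _) (repr _) hu hv => y' x' hu hv.
exists (denomM u v) => /=.
transitivity (sval v * d_ y * d_ y' * (sval u * (n_ x' * d_ x - n_ x * d_ x'))
            + sval u * d_ x * d_ x' * (sval v * (n_ y' * d_ y - n_ y * d_ y'))).
  by ring.
by rewrite hu hv !mulr0 addr0.
Qed.
Canonical pi_add_morph := PiMorph2 pi_add.

Definition oppf (x : frac) : frac := (- n_ x, x.2).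
Definition opp := lift_op1 type oppf.

Lemma pi_opp : {morph \pi : x / oppf x >-> opp x}.
Proof.
move=> x; unlock opp; apply/esym/eqP/equivlP.
have [u hu] := repr_equivl x; exists u => /=.
by rewrite !mulNr -opprD mulrN hu oppr0.
Qed.
Canonical pi_opp_morph := PiMorph1 pi_opp.

Definition mulf (x y : frac) : frac := (n_ x * n_ y, denomM x.2 y.2).
Definition mul := lift_op2 type mulf.

Lemma pi_mul : {morph \pi : x y / mulf x y >-> mul x y}.
Proof.
move=> x y; unlock mul; apply/esym/eqP/equivlP.
have [u hu] := repr_equivl x; have [v hv] := repr_equivl y.
move: (repr _) (repr _) hu hv => y' x' hu hv.
exists (denomM u v) => /=.
transitivity (sval v * n_ y' * d_ y * (sval u * (n_ x' * d_ x - n_ x * d_ x'))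
            + sval u * n_ x * d_ x' * (sval v * (n_ y' * d_ y - n_ y * d_ y'))).
  by ring.
by rewrite hu hv !mulr0 addr0.
Qed.
Canonical pi_mul_morph := PiMorph2 pi_mul.

Definition zero : type := lift_cst type (0, denom1).
Canonical pi_zero_morph := PiConst zero.
Definition one : type := lift_cst type (1, denom1).
Canonical pi_one_morph := PiConst one.

Lemma addA : associative add.
Proof.
elim/quotW=> x; elim/quotW=> y; elim/quotW=> z; rewrite !piE.
by apply: equivl1 => /=; ring.
Qed.

Lemma addC : commutative add.
Proof.
by elim/quotW=> x; elim/quotW=> y; rewrite !piE; apply: equivl1 => /=; ring.
Qed.

Lemma add0 : left_id zero add.
Proof. by elim/quotW=> x; rewrite !piE; apply: equivl1 => /=; ring. Qed.

Lemma addN : left_inverse zero opp add.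
Proof. by elim/quotW=> x; rewrite !piE; apply: equivl1 => /=; ring. Qed.

#[export] HB.instance Definition _ := GRing.isZmodule.Build type addA addC add0 addN.

Lemma mulA : associative mul.
Proof.
elim/quotW=> x; elim/quotW=> y; elim/quotW=> z; rewrite !piE.
by apply: equivl1 => /=; ring.
Qed.

Lemma mulC : commutative mul.
Proof.
by elim/quotW=> x; elim/quotW=> y; rewrite !piE; apply: equivl1 => /=; ring.
Qed.

Lemma mul1 : left_id one mul.
Proof. by elim/quotW=> x; rewrite !piE; apply: equivl1 => /=; ring. Qed.

Lemma mulDl : left_distributive mul add.
Proof.
elim/quotW=> x; elim/quotW=> y; elim/quotW=> z; rewrite !piE.
by apply: equivl1 => /=; ring.
Qed.

Lemma one_neq0 : one != zero.
Proof.
rewrite !piE; apply/negP => /asboolP[u] /=; rewrite mulr1 mul0r subr0 mulr1 => u0.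
by have := svalP u; rewrite u0 idealr0.
Qed.

#[export] HB.instance Definition _ :=
  GRing.Zmodule_isComNzRing.Build type mulA mulC mul1 mulDl one_neq0.

Definition of_base (a : A) : type := \pi_type (a, denom1).

Lemma of_base_zmod_morphism : zmod_morphism of_base.
Proof.
move=> a b; rewrite -[RHS]/(add _ (opp _)) /of_base !piE.
by apply: equivl1 => /=; ring.
Qed.

Lemma of_base_monoid_morphism : monoid_morphism of_base.
Proof.
split=> [|a b]; first by rewrite -[RHS]/one /of_base !piE.
by rewrite -[RHS]/(mul _ _) /of_base !piE; apply: equivl1 => /=; ring.
Qed.

#[export] HB.instance Definition _ :=
  GRing.isZmodMorphism.Build A type of_base of_base_zmod_morphism.
#[export] HB.instance Definition _ :=
  GRing.isMonoidMorphism.Build A type of_base of_base_monoid_morphism.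

End Localization.
Module Exports. HB.reexport. End Exports.
End Localization.
Export Localization.Exports.

Notation localization := Localization.type.
Notation to_localization := Localization.of_base.

Section LocalizationTheory.
Import Localization.
Variables (A : comNzRingType) (P : prime_idealr A).
Local Notation loc := (to_localization P).

Lemma localization_unit (s : A) :
  s \notin P -> exists t : localization P, t * loc s = 1.
Proof.
move=> sP; exists (\pi_(localization P) (1, exist (fun s => s \notin P) s sP)).
rewrite -[LHS]/(Localization.mul _ _) -[RHS]/(Localization.one P).
by rewrite /Localization.of_base !piE; apply: Localization.equivl1 => /=; ring.
Qed.

Lemma localization_surj (t : localization P) :
  exists a s, s \notin P /\ t * loc s = loc a.
Proof.
elim/quotW: t => -[a s]; exists a, (sval s); split; first by case: s.
rewrite -[LHS]/(Localization.mul _ _) /Localization.of_base !piE.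
by apply: Localization.equivl1 => /=; ring.
Qed.

Lemma localization_eq0 (a : A) :
  loc a = 0 <-> exists2 s, s \notin P & s * a = 0.
Proof.
rewrite -[0]/(Localization.zero P) /Localization.of_base !piE; split.
  move=> /eqP/Localization.equivlP[u] /=.
  by rewrite mulr1 mul0r subr0 => u0; exists (sval u); first by case: u {u0}.
move=> [s sP sa]; apply/eqP/Localization.equivlP.
by exists (exist (fun s => s \notin P) s sP); rewrite /= mulr1 mul0r subr0.
Qed.

End LocalizationTheory.

Section QuotientModule.
Variables (A : comNzRingType) (M : lmodType A) (N : submodClosed M).

Lemma submod_zmod_closed : zmod_closed N.
Proof. exact/GRing.submod_closedB/submodClosedP. Qed.

Definition submod_zmod : zmodClosed M :=
  HB.pack (N : {pred M})
    (GRing.isZmodClosed.Build M (N : {pred M}) submod_zmod_closed).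

Definition quotmod : Type := Quotient.quot submod_zmod.
HB.instance Definition _ := GRing.Zmodule.on quotmod.

Definition to_quotmod (x : M) : quotmod := \pi_(Quotient.quot submod_zmod) x.

Lemma to_quotmodP x y : to_quotmod x = to_quotmod y <-> x - y \in N.
Proof.
rewrite -[x - y \in N]/(x - y \in submod_zmod) Quotient.idealrBE.
by split=> [h|/eqP//]; apply/eqP.
Qed.

Lemma to_quotmod_surj (x : quotmod) : exists y, x = to_quotmod y.
Proof. by exists (repr x); rewrite /to_quotmod reprK. Qed.

Lemma to_quotmodD : {morph to_quotmod : x y / x + y}.
Proof. by move=> x y; rewrite /to_quotmod raddfD. Qed.

Definition quotmod_scale (a : A) (x : quotmod) : quotmod :=
  to_quotmod (a *: (repr x : M)).

Lemma to_quotmodZ a x : to_quotmod (a *: x) = quotmod_scale a (to_quotmod x).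
Proof.
apply/to_quotmodP; rewrite -scalerBr rpredZ //.
by apply/to_quotmodP; rewrite /to_quotmod reprK.
Qed.

Lemma quotmod_scaleA a b x :
  quotmod_scale a (quotmod_scale b x) = quotmod_scale (a * b) x.
Proof.
by have [y ->] := to_quotmod_surj x; rewrite -!to_quotmodZ scalerA.
Qed.

Lemma quotmod_scale1 : left_id 1 quotmod_scale.
Proof.
by move=> x; have [y ->] := to_quotmod_surj x; rewrite -to_quotmodZ scale1r.
Qed.

Lemma quotmod_scaleDr : right_distributive quotmod_scale +%R.
Proof.
move=> a x y.
have [x' ->] := to_quotmod_surj x; have [y' ->] := to_quotmod_surj y.
by rewrite -!to_quotmodZ -!to_quotmodD -to_quotmodZ scalerDr.
Qed.

Lemma quotmod_scaleDl x : {morph quotmod_scale^~ x : a b / a + b}.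
Proof.
move=> a b; have [y ->] := to_quotmod_surj x.
by rewrite -!to_quotmodZ -to_quotmodD scalerDl.
Qed.

HB.instance Definition _ := GRing.Zmodule_isLmodule.Build A quotmod
  quotmod_scaleA quotmod_scale1 quotmod_scaleDr quotmod_scaleDl.

Lemma to_quotmod_linear : linear to_quotmod.
Proof. by move=> a x y; rewrite to_quotmodD to_quotmodZ. Qed.

HB.instance Definition _ :=
  GRing.isLinear.Build A M quotmod _ to_quotmod to_quotmod_linear.

End QuotientModule.

Record complex (A : comNzRingType) := Complex {
  cpx_obj :> nat -> lmodType A;
  cpx_diff : forall n, {linear cpx_obj n -> cpx_obj n.+1};
  cpx_diffK : forall n x, cpx_diff n.+1 (cpx_diff n x) = 0
}.

Arguments cpx_diff {A} c n.

(* The image of the incoming differential, zero in degree 0. *)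
Definition boundary (A : comNzRingType) (C : complex A) n : {pred C n} :=
  match n return C n -> bool with
  | 0%N => fun x => x == 0
  | m.+1 => fun x => `[< exists y, cpx_diff C m y = x >]
  end.

Lemma boundary_submod (A : comNzRingType) (C : complex A) n :
  submod_closed (@boundary A C n).
Proof.
case: n => [|n]; split=> [|a x y]; rewrite !unfold_in //=.
- by move=> /eqP-> /eqP->; rewrite scaler0 addr0.
- by apply/asboolP; exists 0; rewrite linear0.
move=> /asboolP[x1 <-] /asboolP[y1 <-]; apply/asboolP.
by exists (a *: x1 + y1); rewrite linearP.
Qed.

Section Cohomology.
Variables (A : comNzRingType) (C : complex A) (n : nat).

Definition is_cocycle : {pred C n} := fun x => cpx_diff C n x == 0.

Lemma is_cocycle_submod : submod_closed is_cocycle.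
Proof.
split=> [|a x y]; rewrite !unfold_in ?linear0 // linearP.
by move=> /eqP-> /eqP->; rewrite scaler0 addr0.
Qed.

HB.instance Definition _ :=
  GRing.isSubmodClosed.Build A (C n) is_cocycle is_cocycle_submod.

Record cocycle : Type :=
  Cocycle { cocycle_val :> C n; cocycleP : cocycle_val \in is_cocycle }.
HB.instance Definition _ := [isSub for cocycle_val].
HB.instance Definition _ := [Choice of cocycle by <:].
HB.instance Definition _ :=
  [SubChoice_isSubLmodule of cocycle by <:].

Lemma cocycle_val_linear : linear cocycle_val.
Proof. by []. Qed.

HB.instance Definition _ :=
  GRing.isLinear.Build A cocycle (C n) _ cocycle_val cocycle_val_linear.

Definition is_coboundary : {pred cocycle} :=
  fun z => boundary (cocycle_val z).

Lemma is_coboundary_submod : submod_closed is_coboundary.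
Proof.
have [b0 bP] := boundary_submod C n.
split=> [|a x y]; rewrite !unfold_in /is_coboundary.
  by rewrite (_ : cocycle_val 0 = 0) //; exact: linear0.
by rewrite linearP; apply: bP.
Qed.

HB.instance Definition _ :=
  GRing.isSubmodClosed.Build A cocycle is_coboundary is_coboundary_submod.

Definition cohomology : Type := quotmod is_coboundary.
HB.instance Definition _ := GRing.Lmodule.on cohomology.

Definition coh_class (z : cocycle) : cohomology := to_quotmod is_coboundary z.

End Cohomology.

Arguments is_cocycle {A} C n.

Section CohomologyTheory.
Variables (A : comNzRingType) (C : complex A) (n : nat).

Lemma coh_class_surj (x : cohomology C n) : exists z, x = coh_class z.
Proof. exact: to_quotmod_surj. Qed.

Lemma coh_class_eq (z w : cocycle C n) :
  coh_class z = coh_class w <-> boundary (cocycle_val z - cocycle_val w).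
Proof.
rewrite to_quotmodP unfold_in /is_coboundary.
by have -> : cocycle_val (z - w) = cocycle_val z - cocycle_val w by exact: linearB.
Qed.

Lemma cocycle_diff (z : cocycle C n) : cpx_diff C n (cocycle_val z) = 0.
Proof. exact/eqP/(cocycleP z). Qed.

End CohomologyTheory.

Record chain_map (A : comNzRingType) (C D : complex A) := ChainMap {
  chain_fun :> forall n, {linear C n -> D n};
  chain_comm : forall n x,
    chain_fun n.+1 (cpx_diff C n x) = cpx_diff D n (chain_fun n x)
}.

Lemma boundary_chain_map (A : comNzRingType) (C D : complex A)
    (f : chain_map C D) n (x : C n) : boundary x -> boundary (f n x).
Proof.
case: n x => [|n] x /=; first by move=> /eqP->; rewrite linear0.
by move=> /asboolP[y <-]; apply/asboolP; exists (f n y); rewrite chain_comm.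
Qed.

Section InducedMap.
Variables (A : comNzRingType) (C D : complex A) (f : chain_map C D) (n : nat).

Lemma map_cocycle_subproof (z : cocycle C n) :
  f n (cocycle_val z) \in is_cocycle D n.
Proof. by rewrite unfold_in -chain_comm cocycle_diff linear0. Qed.

Definition map_cocycle (z : cocycle C n) : cocycle D n :=
  Cocycle (map_cocycle_subproof z).

Definition map_coh (x : cohomology C n) : cohomology D n :=
  coh_class (map_cocycle (repr x)).

Lemma map_coh_class (z : cocycle C n) :
  map_coh (coh_class z) = coh_class (map_cocycle z).
Proof.
have : coh_class (repr (coh_class z)) = coh_class z by exact: reprK.
rewrite /map_coh; move: (repr _) => w /coh_class_eq wz.
by apply/coh_class_eq; rewrite /= -linearB; exact: boundary_chain_map.
Qed.

End InducedMap.

Definition short_exact (A : comNzRingType) (C' C C'' : complex A)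
    (j : chain_map C' C) (q : chain_map C C'') : Prop :=
  forall n, [/\ injective (j n), forall z, exists x, q n x = z
    & forall x, q n x = 0 <-> exists y, j n y = x].

Section Connecting.
Variables (A : comNzRingType) (C' C C'' : complex A).
Variables (j : chain_map C' C) (q : chain_map C C'') (n : nat).

(* The snake relation: z lifts to x in C, and dx comes from w. *)
Definition connecting_rel (a : cohomology C'' n) (b : cohomology C' n.+1) :=
  exists z w x, [/\ a = coh_class z, b = coh_class w,
    q n x = cocycle_val z & j n.+1 (cocycle_val w) = cpx_diff C n x].

(* By [connecting_relP] below, the relation is the graph of a function as soon
   as [short_exact j q]; the default value 0 of [xget] is then not used. *)
Definition connecting (a : cohomology C'' n) : cohomology C' n.+1 :=
  xget 0 [set b | connecting_rel a b].

Hypothesis ex : short_exact j q.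

Lemma boundary_lift (s : C'' n) :
  boundary s -> exists t : C n, s = q n t /\ cpx_diff C n t = 0.
Proof.
case: n s => [|m] s /=; first by move=> /eqP->; exists 0; rewrite !linear0.
move=> /asboolP[s1 <-]; have [_ qsurj _] := ex m; have [t1 <-] := qsurj s1.
by exists (cpx_diff C m t1); rewrite chain_comm cpx_diffK.
Qed.

Lemma connecting_rel_total a : exists b, connecting_rel a b.
Proof.
have [z ->] := coh_class_surj a.
have [_ qsurj _] := ex n; have [x qx] := qsurj (cocycle_val z).
have [_ _ exS] := ex n.+1.
have /exS[y jy] : q n.+1 (cpx_diff C n x) = 0.
  by rewrite chain_comm qx cocycle_diff.
have yP : y \in is_cocycle C' n.+1.
  have [jinj _ _] := ex n.+2; rewrite unfold_in; apply/eqP/jinj.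
  by rewrite chain_comm jy cpx_diffK linear0.
by exists (coh_class (Cocycle yP)), z, (Cocycle yP), x.
Qed.

Lemma connecting_rel_functional a b c :
  connecting_rel a b -> connecting_rel a c -> b = c.
Proof.
move=> [z [w [x [az bw qx jw]]]] [z' [w' [x' [az' cw' qx' jw']]]].
rewrite bw cw'; apply/coh_class_eq; apply/asboolP.
have [jinj _ _] := ex n.+1; have [_ _ exn] := ex n.
have [t qt] : exists t : C n, q n (x - x') = q n t /\ cpx_diff C n t = 0.
  rewrite linearB qx qx'; apply: boundary_lift; apply/coh_class_eq.
  by rewrite -az az'.
have /exn[y jy] : q n (x - x' - t) = 0 by rewrite linearB qt.1 subrr.
exists y; apply: jinj; rewrite chain_comm jy [RHS]linearB jw jw'.
by rewrite !linearB qt.2 subr0.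
Qed.

Lemma connecting_relP a b : connecting_rel a b <-> connecting a = b.
Proof.
have [c ac] := connecting_rel_total a.
have aP : connecting_rel a (connecting a) by exact: (xgetPex 0 (ex_intro _ c ac)).
split=> [ab|<- //]; exact: connecting_rel_functional aP ab.
Qed.

End Connecting.

Section Torsion.
Variables (A : comNzRingType) (I : set A) (M : lmodType A).

Definition is_torsion : {pred M} :=
  fun x => `[< exists n, forall a, ideal_exp I n a -> a *: x = 0 >].

Lemma is_torsion_submod : submod_closed is_torsion.
Proof.
split=> [|b x y]; rewrite !unfold_in.
  by apply/asboolP; exists 0%N => a _; rewrite scaler0.
move=> /asboolP[m xm] /asboolP[n yn]; apply/asboolP; exists (maxn m n) => a aI.
rewrite scalerDr scalerA mulrC -scalerA xm ?scaler0 ?add0r ?yn //.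
  exact: ideal_exp_decr (leq_maxr m n) _ aI.
exact: ideal_exp_decr (leq_maxl m n) _ aI.
Qed.

HB.instance Definition _ :=
  GRing.isSubmodClosed.Build A M is_torsion is_torsion_submod.

Record torsion : Type :=
  Torsion { torsion_val :> M; torsionP : torsion_val \in is_torsion }.
HB.instance Definition _ := [isSub for torsion_val].
HB.instance Definition _ := [Choice of torsion by <:].
HB.instance Definition _ := [SubChoice_isSubLmodule of torsion by <:].

Lemma torsion_val_linear : linear torsion_val.
Proof. by []. Qed.

HB.instance Definition _ :=
  GRing.isLinear.Build A torsion M _ torsion_val torsion_val_linear.

End Torsion.

Arguments is_torsion {A} I M.

Section TorsionMap.
Variables (A : comNzRingType) (I : set A) (M N : lmodType A).
Variable f : {linear M -> N}.

Lemma map_torsion_subproof (x : torsion I M) :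
  f (torsion_val x) \in is_torsion I N.
Proof.
have /asboolP[n xn] := torsionP x; apply/asboolP; exists n => a aI.
by rewrite -linearZ xn ?linear0.
Qed.

Definition map_torsion (x : torsion I M) : torsion I N :=
  Torsion (map_torsion_subproof x).

Lemma map_torsion_linear : linear map_torsion.
Proof. by move=> a x y; apply: val_inj; rewrite /= linearP. Qed.

HB.instance Definition _ := GRing.isLinear.Build A (torsion I M) (torsion I N) _
  map_torsion map_torsion_linear.

End TorsionMap.

Section TorsionComplex.
Variables (A : comNzRingType) (I : set A).

Lemma torsion_complex_diffK (C : complex A) n (x : torsion I (C n)) :
  map_torsion (cpx_diff C n.+1) (map_torsion (cpx_diff C n) x) = 0.
Proof. by apply: val_inj; rewrite /= cpx_diffK. Qed.

Definition torsion_complex (C : complex A) : complex A :=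
  Complex (@torsion_complex_diffK C).

Lemma torsion_chain_comm (C D : complex A) (f : chain_map C D) n
    (x : torsion I (C n)) :
  map_torsion (f n.+1) (map_torsion (cpx_diff C n) x) =
  map_torsion (cpx_diff D n) (map_torsion (f n) x).
Proof. by apply: val_inj; rewrite /= chain_comm. Qed.

Definition torsion_chain (C D : complex A) (f : chain_map C D) :
    chain_map (torsion_complex C) (torsion_complex D) :=
  @ChainMap A (torsion_complex C) (torsion_complex D)
    (fun n => map_torsion (f n)) (@torsion_chain_comm C D f).

End TorsionComplex.

Definition injective_module (A : comNzRingType) (E : lmodType A) : Prop :=
  forall (M N : lmodType A) (f : {linear M -> N}) (g : {linear M -> E}),
    injective f -> exists h : {linear N -> E}, forall x, h (f x) = g x.

Record injective_resolution (A : comNzRingType) (M : lmodType A) :=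
    InjectiveResolution {
  res_cpx :> complex A;
  res_aug : {linear M -> res_cpx 0%N};
  res_aug_inj : injective res_aug;
  res_exact0 : forall x : res_cpx 0%N,
    cpx_diff res_cpx 0 x = 0 -> exists m, res_aug m = x;
  res_aug_diff : forall m, cpx_diff res_cpx 0 (res_aug m) = 0;
  res_exact : forall n (x : res_cpx n.+1),
    cpx_diff res_cpx n.+1 x = 0 -> exists y, cpx_diff res_cpx n y = x;
  res_injective : forall n, injective_module (res_cpx n)
}.

Definition lifts (A : comNzRingType) (M N : lmodType A)
    (E : injective_resolution M) (F : injective_resolution N)
    (f : chain_map E F) (h : M -> N) : Prop :=
  forall m, f 0%N (res_aug E m) = res_aug F (h m).

(* The right derived functors of the torsion functor, at [M]; they do not depend
   on the injective resolution [E] of [M], up to unique isomorphism. *)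
Definition local_cohomology (A : comNzRingType) (I : set A) (M : lmodType A)
    (E : injective_resolution M) (n : nat) : lmodType A :=
  cohomology (torsion_complex I E) n.

(* Degree [n - 1]; zero when [n = 0]. *)
Definition local_cohomology_pred (A : comNzRingType) (I : set A)
    (M : lmodType A) (E : injective_resolution M) (n : nat) : lmodType A :=
  if n is m.+1 then local_cohomology I E m else 'rV[A]_0.

(* An injective subcomplex splits off degreewise, so torsion preserves
   exactness and [connecting] applies to torsion complexes of resolutions. *)
Lemma torsion_short_exact (A : comNzRingType) (I : set A)
    (M : lmodType A) (E : injective_resolution M) (C D : complex A)
    (j : chain_map E C) (q : chain_map C D) :
  short_exact j q -> short_exact (torsion_chain I j) (torsion_chain I q).
Proof.
move=> ex n; have [jinj qsurj exn] := ex n.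
have qj y : q n (j n y) = 0 by apply/exn; exists y.
split.
- by move=> x y [] /jinj xy; apply: val_inj.
- move=> z; have [x qx] := qsurj (torsion_val z).
  have [r rj] := @res_injective _ _ E n _ _ (j n) idfun jinj.
  have xP : x - j n (r x) \in is_torsion I (C n).
    have /asboolP[m zm] := torsionP z; apply/asboolP; exists m => a aI.
    have /exn[y jy] : q n (a *: (x - j n (r x))) = 0.
      by rewrite linearZ linearB qx qj subr0; exact: zm.
    have: r (j n y) = 0 by rewrite jy linearZ linearB rj /= subrr scaler0.
    by rewrite rj /= => y0; rewrite -jy y0 linear0.
  exists (Torsion xP); apply: val_inj; rewrite /= linearB qx.
  by rewrite qj subr0.
move=> x; split=> [/(congr1 (@torsion_val _ _ _))|[y <-]]; last first.
  by apply: val_inj => /=; apply/exn; exists (torsion_val y).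
move=> /exn[y jy]; have yP : y \in is_torsion I (E n).
  have /asboolP[m xm] := torsionP x; apply/asboolP; exists m => a aI.
  by apply: jinj; rewrite linearZ /= jy xm ?linear0.
by exists (Torsion yP); apply: val_inj.
Qed.

Section PrincipalIdeal.
Variables (A : comNzRingType) (u : A).

Definition principal : {pred A^o} := fun x => `[< exists b, x = u * b >].

Lemma principal_submod : submod_closed principal.
Proof.
split=> [|a x y]; rewrite !unfold_in.
  by apply/asboolP; exists 0; rewrite mulr0.
move=> /asboolP[b ->] /asboolP[c ->]; apply/asboolP; exists (a * b + c).
by rewrite -[a *: _]/(a * _); ring.
Qed.

HB.instance Definition _ :=
  GRing.isSubmodClosed.Build A A^o principal principal_submod.

End PrincipalIdeal.

(* The chain maps [bock_mul] and [bock_proj] resolve the short exact sequence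
   0 -> A -> A -> A/uA -> 0 and yield the connecting homomorphism, whose target
   H(A) is computed by [bock_sub].  The second map of the Bockstein composite,
   H(A) -> H(A/uA), must start from the same resolution of A: it is induced by
   [bock_red], a lift of the projection, which is unique up to homotopy. *)
Record bockstein_data (A : comNzRingType) (u : A) := BocksteinData {
  bock_sub : injective_resolution A^o;
  bock_mid : injective_resolution A^o;
  bock_quo : injective_resolution (quotmod (principal u));
  bock_mul : chain_map bock_sub bock_mid;
  bock_proj : chain_map bock_mid bock_quo;
  bock_red : chain_map bock_sub bock_quo;
  bock_mul_lifts : lifts bock_mul (fun x : A^o => u * x : A^o);
  bock_proj_lifts : lifts bock_proj (to_quotmod (principal u));
  bock_red_lifts : lifts bock_red (to_quotmod (principal u));
  bock_exact : short_exact bock_mul bock_proj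
}.

Section Bockstein.
Variables (A : comNzRingType) (u : A) (B : bockstein_data u) (I : set A).

Definition bockstein_delta n :
    local_cohomology I (bock_quo B) n -> local_cohomology I (bock_sub B) n.+1 :=
  @connecting A _ _ _ (torsion_chain I (bock_mul B))
    (torsion_chain I (bock_proj B)) n.

Lemma bockstein_deltaP n a b :
  connecting_rel (torsion_chain I (bock_mul B)) (torsion_chain I (bock_proj B))
    a b <-> @bockstein_delta n a = b.
Proof. exact/connecting_relP/torsion_short_exact/bock_exact. Qed.

Definition bockstein_pi n :
    local_cohomology I (bock_sub B) n -> local_cohomology I (bock_quo B) n :=
  @map_coh A _ _ (torsion_chain I (bock_red B)) n.

Definition bockstein n :
    local_cohomology_pred I (bock_quo B) n -> local_cohomology I (bock_quo B) n :=
  match n with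
  | 0%N => fun _ => 0
  | m.+1 => fun x => @bockstein_pi m.+1 (@bockstein_delta m x)
  end.

End Bockstein.

Arguments bockstein_delta {A u} B I n.
Arguments bockstein_pi {A u} B I n.
Arguments bockstein {A u} B I n.

(* [X] is the inner variable and [Y] the outer one. *)
Definition ZXY : comNzRingType := {poly {poly int}}.
Definition varX : ZXY := ('X : {poly int})%:P.
Definition varY : ZXY := 'X.

Section RamifiedRing.
Variable p : nat.

Definition XYp_ideal : {pred ZXY} :=
  fun g => `[< exists h, g = h * (varX * varY - p%:R) >].

Lemma XYp_ideal_closed : idealr_closed XYp_ideal.
Proof.
split; rewrite ?unfold_in.
- by apply/asboolP; exists 0; rewrite mul0r.
- apply/asboolP => -[h hE].
  have sz : size (varX * varY - p%:R : {poly {poly int}}) = 2%N.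
    rewrite /varX /varY -(polyC_natr _ p) -polyCN size_MXaddC size_polyC.
    by rewrite polyC_eq0 polyX_eq0.
  have h0 : h != 0 by apply: contra_eqN hE => /eqP->; rewrite mul0r oner_eq0.
  have f0 : (varX * varY - p%:R : {poly {poly int}}) != 0.
    by rewrite -size_poly_eq0 sz.
  have := congr1 (fun g : {poly {poly int}} => size g) hE.
  rewrite size_poly1 size_mul // sz addnS /= addn1 => -[/esym/eqP].
  by rewrite size_poly_eq0 (negPf h0).
- move=> a x y; rewrite !unfold_in => /asboolP[h ->] /asboolP[k ->].
  by apply/asboolP; exists (a * h + k); ring.
Qed.

HB.instance Definition _ := isIdealr.Build ZXY XYp_ideal XYp_ideal_closed.

Definition XYp_quot : comNzRingType := {ideal_quot XYp_ideal}.

Definition to_XYp_quot (g : ZXY) : XYp_quot := \pi_{ideal_quot XYp_ideal} g.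

Lemma to_XYp_quot_zmod_morphism : zmod_morphism to_XYp_quot.
Proof. exact: raddfB. Qed.
Lemma to_XYp_quot_monoid_morphism : monoid_morphism to_XYp_quot.
Proof. by split; [exact: rmorph1 | exact: rmorphM]. Qed.
HB.instance Definition _ :=
  GRing.isZmodMorphism.Build ZXY XYp_quot to_XYp_quot to_XYp_quot_zmod_morphism.
HB.instance Definition _ := GRing.isMonoidMorphism.Build ZXY XYp_quot to_XYp_quot
  to_XYp_quot_monoid_morphism.

Lemma to_XYp_quot_surj q : exists g, q = to_XYp_quot g.
Proof. by exists (repr q); rewrite /to_XYp_quot reprK. Qed.

Lemma to_XYp_quot_eq g h :
  to_XYp_quot g = to_XYp_quot h <-> exists k, g - h = k * (varX * varY - p%:R).
Proof.
split=> [/eqP|[k ghE]]; first by rewrite -Quotient.idealrBE => /asboolP.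
by apply/eqP; rewrite -Quotient.idealrBE; apply/asboolP; exists k.
Qed.

Definition origin : {pred XYp_quot} :=
  fun q => `[< ideal_span [set to_XYp_quot varX; to_XYp_quot varY] q >].

Lemma originP (g : ZXY) : (to_XYp_quot g \in origin) = (p%:Z %| g.[0].[0])%Z.
Proof.
apply/idP/idP => [/asboolP gO|].
  pose K : set XYp_quot :=
    [set q | forall h, to_XYp_quot h = q -> (p%:Z %| h.[0].[0])%Z].
  suff KP (h : ZXY) : (p%:Z %| h.[0].[0])%Z -> K (to_XYp_quot h).
    apply: (gO K) => //.
      split=> [|x y|a x].
      - by rewrite -(rmorph0 to_XYp_quot); apply: KP; rewrite !horner0.
      - have [x' ->] := to_XYp_quot_surj x.
        have [y' ->] := to_XYp_quot_surj y => Kx Ky; rewrite -rmorphD.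
        apply: KP.
        by rewrite !hornerD; apply: rpredD; [exact: Kx | exact: Ky].
      - have [a' ->] := to_XYp_quot_surj a.
        have [x' ->] := to_XYp_quot_surj x => Kx; rewrite -rmorphM.
        apply: KP.
        by rewrite !hornerM; apply/dvdz_mull/Kx.
    by move=> _ [] ->; apply: KP; rewrite ?hornerC ?hornerX ?horner0.
  move=> hp k /to_XYp_quot_eq[c kE].
  have {kE} -> : k = c * (varX * varY - p%:R) + h by rewrite -kE subrK.
  rewrite hornerD [X in (_ %| X)%Z]hornerD; apply: rpredD => //.
  rewrite hornerM [X in (_ %| X)%Z]hornerM; apply: dvdz_mull.
  rewrite hornerD hornerN hornerM hornerX mulr0 add0r -polyC_natr hornerC.
  by rewrite -polyC_natr hornerN hornerC rpredN natz dvdzz.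
move=> /dvdzP[k gE]; apply/asboolP => J [J0 JD JM] JXY.
have JX : J (to_XYp_quot varX) by apply: JXY; left.
have JY : J (to_XYp_quot varY) by apply: JXY; right.
have Jp : J (to_XYp_quot p%:R).
  suff -> : to_XYp_quot p%:R = to_XYp_quot varX * to_XYp_quot varY by exact: JM.
  by rewrite -rmorphM; apply/to_XYp_quot_eq; exists (- 1); ring.
move: gE; elim/poly_ind: g => [|g c _]; first by rewrite rmorph0.
rewrite hornerMXaddC mulr0 add0r => cE.
rewrite [to_XYp_quot _](rmorphD to_XYp_quot (g * varY) c%:P).
rewrite rmorphM; apply: (JD); first exact: JM.
move: cE; elim/poly_ind: c => [|c e _]; first by rewrite polyC0 rmorph0.
rewrite hornerMXaddC mulr0 add0r => ->.
have -> : (c * 'X + (k * p%:Z)%:P)%:P = c%:P * varX + k%:P%:P * p%:R :> ZXY.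
  by rewrite polyCD polyCM -natz polyCM polyCM !polyC_natr.
by rewrite rmorphD !rmorphM; apply: JD; apply: JM.
Qed.

Lemma origin_closed (p_pr : prime p) : idealr_closed origin.
Proof.
have [_ spD spM] := ideal_spanP [set to_XYp_quot varX; to_XYp_quot varY].
split.
- by rewrite -(rmorph0 to_XYp_quot) originP !horner0.
- by rewrite -(rmorph1 to_XYp_quot) originP !hornerC dvdz1 absz_nat; case: p p_pr => [|[]].
- move=> a x y /asboolP xO /asboolP yO; apply/asboolP.
  by apply: spD => //; apply: spM.
Qed.

Lemma origin_prime_closed (p_pr : prime p) : prime_idealr_closed origin.
Proof.
move=> x y; have [x' ->] := to_XYp_quot_surj x.
have [y' ->] := to_XYp_quot_surj y; rewrite -rmorphM !originP !hornerM.
by rewrite !dvdzE abszM absz_nat Euclid_dvdM.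
Qed.

Definition origin_prime (p_pr : prime p) : prime_idealr XYp_quot :=
  HB.pack origin (isIdealr.Build XYp_quot origin (origin_closed p_pr))
    (isPrimeIdealrClosed.Build XYp_quot origin (origin_prime_closed p_pr)).

Definition ramified_ring (p_pr : prime p) : comNzRingType :=
  localization (origin_prime p_pr).

Definition to_ramified_ring (p_pr : prime p) (g : ZXY) : ramified_ring p_pr :=
  to_localization (origin_prime p_pr) (to_XYp_quot g).

Lemma to_ramified_ring_zmod_morphism (p_pr : prime p) :
  zmod_morphism (to_ramified_ring p_pr).
Proof. by move=> g h; rewrite /to_ramified_ring !rmorphB. Qed.
Lemma to_ramified_ring_monoid_morphism (p_pr : prime p) :
  monoid_morphism (to_ramified_ring p_pr).
Proof. by split=> [|g h]; rewrite /to_ramified_ring ?rmorph1 ?rmorphM. Qed.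
HB.instance Definition _ (p_pr : prime p) :=
  GRing.isZmodMorphism.Build ZXY (ramified_ring p_pr) (to_ramified_ring p_pr)
    (to_ramified_ring_zmod_morphism p_pr).
HB.instance Definition _ (p_pr : prime p) :=
  GRing.isMonoidMorphism.Build ZXY (ramified_ring p_pr) (to_ramified_ring p_pr)
    (to_ramified_ring_monoid_morphism p_pr).

End RamifiedRing.

Definition contraction (A B : comNzRingType) (f : A -> B) (J : set B) : set A :=
  f @^-1` J.

Definition extension (A B : comNzRingType) (f : A -> B) (I : set A) : set B :=
  ideal_span (f @` I).

(* The ideal generated by [p] is the annihilator of an element of the
   Z-module [M]. *)
Definition Z_associated (M : zmodType) (p : int) : Prop :=
  exists x : M, forall n : int, x *~ n = 0 <-> (p %| n)%Z.

(* Main.v *)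
(** Write [f = XY - p], [N = T/pT] and let [a] be one of [X], [Y].  Extension
inverts contraction, so [IT = J], and [J] may be assumed nonzero.  As [T/pT] is
one-dimensional, [H^i_J(N) = 0] for [i >= 2]: modulo [p] the ideal [J] is
principal up to radical, and a homotopy contracting multiplication by [p] on an
injective resolution of [N] turns torsion for a single element of [J] into
[J]-torsion.  Only [i = 1] remains.  If [J] is contained in neither [XT] nor
[YT], then [J] contains a nonzerodivisor on [N] and [H^0_J(N) = 0].  If [J] is
contained in [aT], then [I] is contained in the height two prime
[(a, f) = (a, p)] of [R], and [1/(a f)] gives a nonzero class of [H^2_I(R)]
annihilated by [p], which the hypothesis excludes. *)
Require Import Defs.
From HB Require Import structures.
From mathcomp Require Import all_boot all_algebra.
From mathcomp Require Import boolp classical_sets.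
From mathcomp Require Import ring.

Set Implicit Arguments.
Unset Strict Implicit.
Unset Printing Implicit Defensive.

Import GRing.Theory.

Local Open Scope classical_set_scope.
Local Open Scope ring_scope.

(** * Powers of an ideal *)

Section IdealPowers.
Variables (A : comNzRingType) (J : set A).

Lemma ideal_exp_pow (h : A) n : J h -> ideal_exp J n (h ^+ n).
Proof.
move=> Jh; elim: n => [|n IHn] //.
by apply: sub_ideal_span; exists h, (h ^+ n); rewrite exprS.
Qed.

Lemma ideal_expD m n :
  ideal_exp J (m + n) `<=` ideal_mul (ideal_exp J m) (ideal_exp J n).
Proof.
elim: m => [|m IHm] x /=.
  by move=> xJ; apply: sub_ideal_span; exists 1, x; rewrite mul1r.
apply; first exact: ideal_spanP.
move=> _ [a [b [Ja /IHm bJ ->]]].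
have [S0 SD SM] := ideal_spanP [set z | exists x y,
  [/\ ideal_exp J m.+1 x, ideal_exp J n y & z = x * y]].
(* For fixed [a], the [b] with [a * b] in the product form an ideal, so generators suffice. *)
apply: (bJ [set b | ideal_mul (ideal_exp J m.+1) (ideal_exp J n) (a * b)]).
  split=> [|u v|c u] /=; first by rewrite mulr0.
    by rewrite mulrDr; apply: SD.
  by rewrite mulrCA; apply: SM.
move=> _ [c [d [cJ dJ ->]]] /=; apply: sub_ideal_span.
exists (a * c), d; split=> //; last by rewrite mulrA.
by apply: sub_ideal_span; exists a, c.
Qed.

Lemma ideal_exp_annihilates (M : lmodType A) (x : M) m n :
  (forall a b, ideal_exp J m a -> ideal_exp J n b -> (a * b) *: x = 0) ->
  forall a, ideal_exp J (m + n) a -> a *: x = 0.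
Proof.
move=> ann a /ideal_expD aJ; apply: (aJ [set a | a *: x = 0]).
  split=> [|u v /= u0 v0|c u /= u0]; first by rewrite /= scale0r.
    by rewrite scalerDl u0 v0 addr0.
  by rewrite -scalerA u0 scaler0.
by move=> _ [u [v [uJ vJ ->]]]; exact: ann.
Qed.

(** An induction principle for powers: [K] is a decreasing filtration to compare with, such as the
    multiples of the powers of an element. *)
Lemma ideal_exp_sub (K : nat -> set A) :
  (forall n, is_ideal (K n)) -> K 0%N 1 ->
  (forall n a b, J a -> K n b -> K n.+1 (a * b)) ->
  forall n, ideal_exp J n `<=` K n.
Proof.
move=> Kid K1 KM; elim=> [|n IHn] x.
  by move=> _; have [_ _ K0M] := Kid 0%N; rewrite -[x]mulr1; apply: K0M.
apply; first exact: Kid.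
by move=> _ [a [b [Ja /IHn Kb ->]]]; exact: KM.
Qed.

End IdealPowers.

(** * Extending and dividing in injective modules *)

Section KernelFactor.
Variables (A : comNzRingType) (M N : lmodType A) (f : {linear M -> N}).

Definition in_kernel : {pred M} := fun x => f x == 0.

Lemma in_kernel_submod : submod_closed in_kernel.
Proof.
split=> [|a x y]; rewrite !unfold_in ?linear0 // linearP.
by move=> /eqP-> /eqP->; rewrite scaler0 addr0.
Qed.

HB.instance Definition _ :=
  GRing.isSubmodClosed.Build A M in_kernel in_kernel_submod.

Lemma kernel_factor (E : lmodType A) (g : {linear M -> E}) :
  (forall x, f x = 0 -> g x = 0) ->
  exists h : {linear quotmod in_kernel -> E},
    forall x, h (to_quotmod in_kernel x) = g x.
Proof.
move=> fg; pose h (x : quotmod in_kernel) : E := g (repr x).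
have hE x : h (to_quotmod in_kernel x) = g x.
  have /to_quotmodP : to_quotmod in_kernel (repr (to_quotmod in_kernel x)) =
    to_quotmod in_kernel x by rewrite {1}/to_quotmod reprK.
  rewrite unfold_in => /eqP/fg; rewrite linearB => /eqP.
  by rewrite subr_eq0 => /eqP.
have h_linear : linear h.
  move=> a x y; have [x' ->] := to_quotmod_surj x.
  have [y' ->] := to_quotmod_surj y.
  by rewrite -linearP !hE linearP.
by exists (HB.pack_for {linear quotmod in_kernel -> E} h
  (GRing.isLinear.Build A _ _ _ h h_linear)).
Qed.

(** Both maps descend to the quotient by the kernel of [f], where [f] becomes injective. *)
Lemma injective_extend (E : lmodType A) (g : {linear M -> E}) :
  injective_module E -> (forall x, f x = 0 -> g x = 0) ->
  exists h : {linear N -> E}, forall x, h (f x) = g x.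
Proof.
move=> Einj /kernel_factor[g' g'E].
have [f' f'E] := @kernel_factor N f (fun _ => id).
have f'inj : injective f'.
  move=> x y; have [x' ->] := to_quotmod_surj x.
  have [y' ->] := to_quotmod_surj y; rewrite !f'E => fxy.
  by apply/to_quotmodP; rewrite unfold_in linearB fxy subrr.
by have [h hE] := Einj _ _ f' g' f'inj; exists h => x; rewrite -g'E -hE f'E.
Qed.

End KernelFactor.

Section Divide.
Variable A : comNzRingType.

Definition ray (M : lmodType A) (x : M) (a : A^o) : M := (a : A) *: x.

Lemma ray_linear (M : lmodType A) (x : M) : linear (ray x).
Proof. by move=> a b c; rewrite /ray scalerDl scalerA. Qed.

HB.instance Definition _ (M : lmodType A) (x : M) :=
  GRing.isLinear.Build A A^o M _ (ray x) (ray_linear x).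

Lemma to_principal_eq0 (u a : A) :
  to_quotmod (principal u) a = 0 <-> exists b, a = u * b.
Proof.
rewrite -(linear0 (to_quotmod (principal u))) to_quotmodP subr0.
by split=> [/asboolP//|h]; apply/asboolP.
Qed.

Lemma injective_extend_point (E N : lmodType A) (n : N) (x : E) :
  injective_module E -> (forall a : A, a *: n = 0 -> a *: x = 0) ->
  exists h : {linear N -> E}, h n = x.
Proof.
move=> Einj nx.
have [|h hE] := @injective_extend A A^o N (ray n) E (ray x) Einj.
  by move=> a; apply: nx.
by exists h; have := hE 1; rewrite /= /ray !scale1r.
Qed.

(* Extends [d |-> x] from the ideal generated by [d] in [A/cA] to [A/cA]. *)
Lemma injective_divide (E : lmodType A) (c d : A) (x : E) :
  injective_module E -> (forall a b, a * d = c * b -> a *: x = 0) ->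
  exists y : E, c *: y = 0 /\ d *: y = x.
Proof.
move=> Einj dx; pose q := to_quotmod (principal c).
have qZ (a b : A) : a *: q b = q (a * b) by exact/esym/to_quotmodZ.
have [|h hd] := @injective_extend_point E _ (q d) x Einj.
  by move=> a; rewrite qZ => /to_principal_eq0[b ab]; exact: dx ab.
exists (h (q 1)); split; rewrite -linearZ.
  suff -> : c *: q 1 = 0 by rewrite linear0.
  by rewrite qZ; apply/to_principal_eq0; exists 1.
by rewrite -hd; congr (h _); rewrite [LHS]qZ mulr1.
Qed.

Lemma injective_divisible (E : lmodType A) (d : A) (x : E) :
  injective_module E -> (forall a, a * d = 0 -> a = 0) ->
  exists y : E, d *: y = x.
Proof.
move=> Einj dreg; have [|y [_ yE]] := @injective_divide E 0 d x Einj.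
  by move=> a b; rewrite mul0r => /dreg->; rewrite scale0r.
by exists y.
Qed.

End Divide.

(** * Vanishing of local cohomology, computed in a fixed injective resolution *)

Section Resolution.
Variables (A : comNzRingType) (N : lmodType A) (Q : injective_resolution N).

(** Multiplication by [u] lifts the zero map of [N], hence is homotopic to zero; only the two
    components meeting degree [j.+1] are kept. *)
Lemma null_homotopy (u : A) j : (forall n : N, u *: n = 0) ->
  exists (k : {linear Q j.+1 -> Q j}) (k' : {linear Q j.+2 -> Q j.+1}),
  forall x, u *: x = cpx_diff Q j (k x) + k' (cpx_diff Q j.+1 x).
Proof.
move=> uN.
(* The hypothesis makes [u - dk] vanish on boundaries, which by exactness form the kernel of the
   next differential; it then extends along that differential. *)
have step l (k : {linear Q l.+1 -> Q l}) :
    (forall x, cpx_diff Q l (u *: x - k (cpx_diff Q l x)) = 0) ->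
    exists k' : {linear Q l.+2 -> Q l.+1},
      forall x, u *: x = cpx_diff Q l (k x) + k' (cpx_diff Q l.+1 x).
  move=> kP; pose g x := u *: x - cpx_diff Q l (k x).
  have g_linear : linear g.
    move=> a x y; rewrite /g (linearP k) (linearP (cpx_diff Q l)).
    by rewrite scalerBr scalerDr !scalerA (mulrC u) opprD addrACA.
  pose G := HB.pack_for {linear Q l.+1 -> Q l.+1} g
    (GRing.isLinear.Build A _ _ _ g g_linear).
  have [x|k' k'E] := @injective_extend _ _ _ (cpx_diff Q l.+1) _ G
      (@res_injective _ _ Q _).
    move=> /res_exact[y <-] /=; rewrite /G /= /g.
    by rewrite -linearZ -linearB kP.
  by exists k' => x; rewrite k'E /G /= /g addrC subrK.
suff [k kP] : exists k : {linear Q j.+1 -> Q j},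
    forall x, cpx_diff Q j (u *: x - k (cpx_diff Q j x)) = 0.
  by have [k' k'E] := step _ _ kP; exists k, k'.
elim: j => [|j [k /step[k' k'E]]]; last first.
  by exists k' => x; rewrite k'E addrK cpx_diffK.
(* The kernel of the first differential is [N], which [u] kills. *)
have [x|k kE] := @injective_extend _ _ _ (cpx_diff Q 0) _
    (GRing.scale_fun u idfun) (@res_injective _ _ Q _).
  by move=> /res_exact0[n <-] /=; rewrite -linearZ uN linear0.
by exists k => x; rewrite kE /= subrr linear0.
Qed.

(** Divisibility corrects a primitive [v0] of [z]: since [h v0] is some [dw], subtracting [d(w/h)]
    makes it killed by [h]. This refines the vanishing of cohomology supported on one element above
    degree one, keeping the annihilator. *)
Lemma principal_cocycle (h : A) j (z : Q j.+2) :
  (forall a, a * h = 0 -> a = 0) -> cpx_diff Q j.+2 z = 0 -> h *: z = 0 ->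
  exists2 v : Q j.+1, cpx_diff Q j.+1 v = z & h *: v = 0.
Proof.
move=> hreg /res_exact[v0 <-] hz.
have /res_exact[w dw] : cpx_diff Q j.+1 (h *: v0) = 0 by rewrite linearZ.
have [w' hw'] := injective_divisible w (@res_injective _ _ Q _) hreg.
exists (v0 - cpx_diff Q j w'); first by rewrite linearB cpx_diffK subr0.
by rewrite scalerBr -linearZ /= hw' dw subrr.
Qed.

(** Everything is torsion for the zero ideal, so the torsion complex is the resolution itself, exact
    in positive degrees. *)
Lemma local_cohomology0 (J : set A) n : (forall t, J t -> t = 0) ->
  forall x : local_cohomology J Q n.+1, x = 0.
Proof.
move=> J0 x; have [z ->] := coh_class_surj x.
have tors (v : Q n) : v \in is_torsion J (Q n).
  apply/asboolP; exists 1%N => a aJ; suff -> : a = 0 by rewrite scale0r.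
  apply: (aJ [set 0]).
    by split=> [//|? ? -> ->|? ? ->]; rewrite ?addr0 ?mulr0.
  by move=> _ [b [c [/J0-> _ ->]]]; rewrite mul0r.
have /(congr1 (@torsion_val _ _ _)) := cocycle_diff z.
move=> /res_exact[v dv].
have -> : 0 = coh_class 0 :> local_cohomology J Q n.+1.
  by rewrite /coh_class linear0.
apply/coh_class_eq; rewrite subr0; apply/asboolP.
by exists (Torsion (tors v)); apply: val_inj.
Qed.

(* With [p = dk + k'd] and [z = dv], where [h^m v = 0], the cochain [v - dy] for
   [p y = k v] is annihilated by [h^(m+1)], and [p (v - dy) = k' z]. *)
Lemma local_cohomology_vanish (J : set A) (p h : A) j :
  (forall n : N, p *: n = 0) -> J h ->
  (forall a, a * h = 0 -> a = 0) ->
  (forall a b m, a * p = h ^+ m.+1 * b -> exists c, a = c * h ^+ m) ->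
  (forall m, exists n, forall a, ideal_exp J n a ->
     exists b c, a = b * h ^+ m + c * p) ->
  forall x : local_cohomology J Q j.+2, x = 0.
Proof.
move=> pN Jh hreg hp Jhp x; have [z ->] := coh_class_surj x.
have /(congr1 (@torsion_val _ _ _)) dz := cocycle_diff z.
have /asboolP[m Jz] := torsionP (cocycle_val z).
move: dz Jz; set z0 := torsion_val (cocycle_val z) => /= dz Jz.
have hmreg a : a * h ^+ m = 0 -> a = 0.
  elim: m {Jz} a => [|m IHm] a; first by rewrite mulr1.
  by rewrite exprS mulrA => /IHm/hreg.
have [v dv hv] := principal_cocycle hmreg dz (Jz _ (ideal_exp_pow m Jh)).
have [k [k' kE]] := null_homotopy j pN.
(* The exponent [m.+1] pays for the power lost in [hp]: if [a p] is a multiple of [h ^+ m.+1], then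
   [a] is one of [h ^+ m], which kills [k v]. *)
have [|y [hy py]] := @injective_divide A _ (h ^+ m.+1) p (k v)
    (@res_injective _ _ Q j).
  by move=> a b /hp[c ->]; rewrite -scalerA -(linearZZ k) /= hv linear0 scaler0.
pose v' := v - cpx_diff Q j y.
have dv' : cpx_diff Q j.+1 v' = z0 by rewrite linearB cpx_diffK subr0.
have pv' : p *: v' = k' z0.
  by rewrite scalerBr kE -linearZ /= py dv addrC addKr.
have hv' : h ^+ m.+1 *: v' = 0.
  by rewrite scalerBr -linearZ /= hy exprS -scalerA hv scaler0 linear0 subr0.
have v't : v' \in is_torsion J (Q j.+1).
  (* Elements of the [n]-th power lie in the ideal of [h ^+ m.+1], which kills [v'], and [p], which
     sends [v'] to [k' z0]; the [m]-th power kills the latter. *)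
  have [n nP] := Jhp m.+1; apply/asboolP; exists (m + n)%N.
  apply: ideal_exp_annihilates => a b aJ /nP[c [e ->]].
  rewrite mulrDr scalerDl !mulrA -!scalerA hv' !scaler0 add0r pv' scalerA.
  by rewrite mulrC -scalerA -(linearZZ k') Jz // linear0 scaler0.
have -> : 0 = coh_class 0 :> local_cohomology J Q j.+2.
  by rewrite /coh_class linear0.
apply/coh_class_eq; rewrite subr0; apply/asboolP.
by exists (Torsion v't); apply: val_inj.
Qed.

(** Cocycles of degree zero come from [N], where a power of the nonzerodivisor [h] kills them. *)
Lemma local_cohomology_depth (J : set A) (h : A) :
  J h -> (forall n : N, h *: n = 0 -> n = 0) ->
  forall x : local_cohomology J Q 0, x = 0.
Proof.
move=> Jh hN x; have [z ->] := coh_class_surj x.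
have /(congr1 (@torsion_val _ _ _)) /res_exact0[n nE] := cocycle_diff z.
have /asboolP[m Jz] := torsionP (cocycle_val z).
have hmn : h ^+ m *: n = 0.
  apply: (@res_aug_inj _ _ Q); rewrite linearZ /= nE linear0.
  exact/Jz/ideal_exp_pow.
have n0 : n = 0.
  elim: m {Jz} hmn => [|m IHm]; first by rewrite scale1r.
  by rewrite exprS -scalerA => /hN/IHm.
have -> : 0 = coh_class 0 :> local_cohomology J Q 0.
  by rewrite /coh_class linear0.
apply/coh_class_eq; rewrite subr0; apply/eqP/val_inj.
by rewrite -[LHS]nE n0 linear0.
Qed.

End Resolution.

(** * A [p]-torsion class in degree two *)

Lemma Z_associatedP (M : zmodType) (p : nat) (x : M) :
  prime p -> x <> 0 -> x *+ p = 0 -> Z_associated M p.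
Proof.
move=> p_pr x0 px; exists x => n; split=> [nx|/dvdzP[k ->]]; last first.
  by rewrite mulrC mulrzA -pmulrn px mul0rz.
case: (boolP (p %| n)%Z) => // pn; case: x0.
(* By Bezout, an annihilator prime to [p] would kill [x]. *)
have /coprimezP[[u v] /= uv] : coprimez p n.
  by rewrite coprimezE absz_nat prime_coprime // -dvdzE in pn *.
by rewrite -[x]mulr1z -uv mulrzDr ![_ * p%:Z]mulrC ![_ * n]mulrC !mulrzA
  -pmulrn px nx !mul0rz addr0.
Qed.

Section Associated.
Variables (R : comNzRingType) (E : injective_resolution R^o) (I : set R).
Variables (a f g : R) (p : nat).
Hypothesis p_pr : prime p.
Hypothesis domR : forall x y : R, x * y = 0 -> x = 0 \/ y = 0.
Hypotheses (a0 : a <> 0) (f0 : f <> 0).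
Hypothesis fa : forall b c, f * b = a * c -> exists d, b = a * d.
Hypothesis f_prime : forall x y c, x * y = f * c ->
  (exists d, x = f * d) \/ (exists d, y = f * d).
Hypotheses (If : I f) (Ig : I g) (gf : ~ exists d, g = f * d).
Hypothesis Iaf : forall x, I x -> exists b c, x = a * b + f * c.
Hypothesis af1 : ~ exists b c, 1 = a * b + f * c.
Hypothesis paf : exists b c, p%:R = a * b + f * c.

Lemma domain_mulrI (b x y : R) : b <> 0 -> b * x = b * y -> x = y.
Proof.
move=> b0 /eqP; rewrite -subr_eq0 -mulrBr => /eqP/domR[//|/eqP].
by rewrite subr_eq0 => /eqP.
Qed.

Lemma domain_expr_neq0 (b : R) (n : nat) : b <> 0 -> b ^+ n <> 0.
Proof.
move=> b0; elim: n => [|n IHn]; first exact/eqP/oner_neq0.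
by rewrite exprS => /domR[].
Qed.

Lemma prime_power_cancel n x y :
  g ^+ n * x = f ^+ n * y -> exists d, x = f ^+ n * d.
Proof.
(* With independent exponents, the outer induction strips factors [f] and the inner one factors [g],
   as the prime [f] does not divide [g]. *)
suff H m k : g ^+ k * x = f ^+ m * y -> exists d, x = f ^+ m * d by exact: H.
elim: m y => [|m IHm] y; first by exists x; rewrite mul1r.
move=> gx; have [|d xE] := IHm (f * y).
  by rewrite gx exprSr mulrA.
move: gx; rewrite xE mulrCA exprSr -mulrA => /domain_mulrI.
move=> /(_ (domain_expr_neq0 f0)) gd.
suff [e ->] : exists e, d = f * e by exists e; rewrite mulrA.
elim: k y {IHm} gd => [|k IHk] y'.
  by rewrite mul1r => ->; exists y'.
by rewrite exprS -mulrA => /f_prime[/gf//|[e /IHk]].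
Qed.

(* The class is [1/(a f)], supported at the height two ideal [(a, f)].  If it
   vanished in [H^2_I], then for some [n] every element [x] of [I^n] would be
   [a r(x) + f q(x)] with [r, q : I^n -> R] linear; comparing the values at the
   coprime elements [f^n] and [g^n], [r] and [q] would be multiplications by
   elements of [R], whence [1 \in (a, f)]. *)
Lemma associated_local_cohomology2 : Z_associated (local_cohomology I E 2) p.
Proof.
have Einj n : injective_module (E n) by exact: res_injective.
have areg x : x * a = 0 -> x = 0 by move=> /domR[].
(* [u0] stands for [1/a]; next, [u1] divides its coboundary by [f] while staying killed by [a], and
   [z = d u1] represents [1/(a f)]. *)
have [u0 au0] := injective_divisible (res_aug E 1) (Einj 0%N) areg.
have [b c bc|u1 [au1 fu1]] :=
    @injective_divide R _ a f (cpx_diff E 0 u0) (Einj 1%N).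
  have [d ->] : exists d, b = a * d by apply: (@fa b c); rewrite mulrC.
  by rewrite mulrC -scalerA -(linearZZ (cpx_diff E 0)) au0 res_aug_diff scaler0.
pose z := cpx_diff E 1 u1.
have az : a *: z = 0 by rewrite -(linearZZ (cpx_diff E 1)) au1 linear0.
have fz : f *: z = 0 by rewrite -(linearZZ (cpx_diff E 1)) fu1 cpx_diffK.
have afz x : (exists b c, x = a * b + f * c) -> x *: z = 0.
  move=> [b [c ->]]; rewrite scalerDl ![_ * b]mulrC ![_ * c]mulrC -!scalerA.
  by rewrite az fz !scaler0 addr0.
have zt : z \in is_torsion I (E 2).
  apply/asboolP; exists 1%N => x xI; apply: (xI [set x | x *: z = 0]).
    split=> [|r s /= rz sz|r s /= sz]; first by rewrite /= scale0r.
      by rewrite scalerDl rz sz addr0.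
    by rewrite -scalerA sz scaler0.
  by move=> _ [r [s [/Iaf/afz rz _ ->]]]; rewrite /= mulrC -scalerA rz scaler0.
pose zT : torsion_complex I E 2 := Torsion zt.
have zc : zT \in is_cocycle (torsion_complex I E) 2.
  by rewrite unfold_in; apply/eqP/val_inj; rewrite /= cpx_diffK.
apply: (@Z_associatedP _ p (coh_class (Cocycle zc))) => //; last first.
  rewrite -scaler_nat /coh_class -(linearZZ (to_quotmod _)).
  rewrite (_ : _ *: _ = 0) ?linear0 //.
  by apply/val_inj/val_inj; apply: afz.
have -> : 0 = coh_class 0 :> local_cohomology I E 2.
  by rewrite /coh_class linear0.
move=> /coh_class_eq; rewrite subr0 => /asboolP[vT].
move=> /(congr1 (@torsion_val _ _ _)) /= dv.
have /asboolP[n Iv] := torsionP vT; set v := torsion_val vT in dv Iv.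
have [s ds] : exists s, cpx_diff E 0 s = u1 - v.
  by apply: res_exact; rewrite linearB dv subrr.
(* The coboundaries of [u0 - f s] and [a s] are [f v] and [- a v], killed by [x], so both elements
   times [x] lie in [R]. The last identity is [x] times [a (u0 - f s) + f (a s) = a u0]. *)
have rq x : ideal_exp I n x -> exists r q,
    [/\ x *: (u0 - f *: s) = res_aug E r, x *: (a *: s) = res_aug E q &
      x = a * r + f * q].
  move=> /Iv xv; have [q qE] : exists q, res_aug E q = x *: (a *: s).
    apply: res_exact0; rewrite !(linearZZ (cpx_diff E 0)) ds scalerBr au1 sub0r.
    by rewrite scalerN !scalerA mulrC -scalerA xv scaler0 oppr0.
  have [r rE] : exists r, res_aug E r = x *: (u0 - f *: s).
    apply: res_exact0; rewrite (linearZZ (cpx_diff E 0)) linearB.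
    rewrite (linearZZ (cpx_diff E 0)) ds [f *: _]scalerBr fu1 opprB addrC subrK.
    by rewrite scalerA mulrC -scalerA xv scaler0.
  exists r, q; split=> //; apply: (@res_aug_inj _ _ E).
  rewrite -[x in LHS]mulr1 linearD.
  have resZ (b c : R) : res_aug E (b * c) = b *: res_aug E c.
    by rewrite -(linearZZ (res_aug E)).
  rewrite !resZ qE rE -au0 !scalerA ![_ * x]mulrC -!scalerA -scalerDr.
  by congr (_ *: _); rewrite scalerBr !scalerA [f * a]mulrC subrK.
have [r [q [rE qE fE]]] := rq _ (ideal_exp_pow n If).
have [r' [q' [rE' qE' _]]] := rq _ (ideal_exp_pow n Ig).
have cross (w : E 0%N) (t t' : R) : f ^+ n *: w = res_aug E t ->
    g ^+ n *: w = res_aug E t' -> exists d, t = f ^+ n * d.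
  move=> tE tE'; apply: (@prime_power_cancel n t t').
  apply: (@res_aug_inj _ _ E); rewrite !(linearZZ (res_aug E)) -tE -tE'.
  by rewrite !scalerA mulrC.
have [d rd] := cross _ _ _ rE rE'; have [e qe] := cross _ _ _ qE qE'.
apply: af1; exists d, e; apply: (domain_mulrI (@domain_expr_neq0 f n f0)).
by rewrite mulr1 {1}fE rd qe; ring.
Qed.

End Associated.

(** The connecting map is picked from a relation rather than built as a linear map, so its value at
    zero is read off from zero representatives. *)
Lemma bockstein_eq0 (A : comNzRingType) (u : A) (B : bockstein_data u)
    (I : set A) n : bockstein_pi B I n.+1 (bockstein_delta B I n 0) = 0.
Proof.
have coh0 (C : complex A) j : 0 = coh_class 0 :> cohomology C j.
  by rewrite /coh_class linear0.
have -> : bockstein_delta B I n 0 = 0.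
  by apply/bockstein_deltaP; exists 0, 0, 0; split; rewrite ?linear0 //;
    exact: coh0.
rewrite /bockstein_pi coh0 map_coh_class [RHS]coh0; congr coh_class.
by apply: val_inj; rewrite /= linear0.
Qed.

(** * The ring [ZXY] and its quotients by [(X, p)] and [(Y, p)] *)

Section Plane.
Variable p : nat.
Hypothesis p_pr : prime p.

Definition XYp : ZXY := varX * varY - p%:R.

Lemma ZXY_domain (x y : ZXY) : x * y = 0 -> x = 0 \/ y = 0.
Proof.
move=> xy; have := mulf_eq0 (x : {poly {poly int}}) y.
by rewrite [_ * _]xy eqxx => /esym/orP[] /eqP; [left | right].
Qed.

Definition var (o : bool) : ZXY := if o then varX else varY.

(** Brings [var o] to the outer position, where evaluation at 0 reduces modulo it; both variables
    are thus treated at once. *)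
Definition flip (o : bool) : {rmorphism ZXY -> ZXY} :=
  if o then (@swapXY int : {rmorphism _ -> _}) else idfun.

Lemma flipK o : involutive (flip o).
Proof. by case: o => // x; exact: swapXYK. Qed.

Lemma flip_varY o : flip o varY = var o.
Proof. by case: o => //; exact: swapXY_X. Qed.

Lemma flip_varX o : flip o varX = var (~~ o).
Proof. by case: o => //; exact: swapXY_Y. Qed.

Lemma XYpE o : XYp = var o * var (~~ o) - p%:R.
Proof. by case: o; rewrite /XYp //= [varY * _]mulrC. Qed.

Lemma flip_XYp o : flip o XYp = XYp.
Proof.
by rewrite {1}/XYp rmorphB rmorphM rmorph_nat flip_varY flip_varX mulrC -XYpE.
Qed.

Lemma flip00 o g : (flip o g).[0].[0] = g.[0].[0].
Proof. by case: o => //; rewrite -[RHS](horner2_swapXY g 0 0). Qed.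

(* [R/(a, p)] as a polynomial ring in the other variable, where [a = var o]. *)
Definition red o (g : ZXY) : {poly 'F_p} := map_poly intr (flip o g).[0].

Lemma red_is_zmod_morphism o : zmod_morphism (red o).
Proof. by move=> g h; rewrite /red rmorphB hornerD hornerN rmorphB. Qed.

Lemma red_is_monoid_morphism o : monoid_morphism (red o).
Proof.
split=> [|g h]; first by rewrite /red rmorph1 hornerC rmorph1.
by rewrite /red rmorphM hornerM rmorphM.
Qed.

HB.instance Definition _ o := GRing.isZmodMorphism.Build ZXY {poly 'F_p} (red o)
  (red_is_zmod_morphism o).
HB.instance Definition _ o := GRing.isMonoidMorphism.Build ZXY {poly 'F_p}
  (red o) (red_is_monoid_morphism o).

Lemma intr_Fp_eq0 (n : int) : (n%:~R == 0 :> 'F_p) = (p %| n)%Z.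
Proof. by rewrite -(dvdz_pcharf (pchar_Fp p_pr)). Qed.

Lemma red_eq0_at0 o g : ((red o g).[0] == 0) = (p %| g.[0].[0])%Z.
Proof.
have := horner_map (intmul 1 : {rmorphism int -> 'F_p}) (flip o g).[0] 0.
by rewrite rmorph0 /red => ->; rewrite flip00 /= intr_Fp_eq0.
Qed.

Lemma red_var o : red o (var o) = 0.
Proof. by rewrite /red -flip_varY flipK hornerX rmorph0. Qed.

Lemma red_other o : red o (var (~~ o)) = 'X.
Proof. by rewrite /red -flip_varX flipK hornerC map_polyX. Qed.

Lemma red_XYp o : red o XYp = 0.
Proof.
rewrite (XYpE o) rmorphB rmorphM /= red_var mul0r sub0r rmorph_nat.
by rewrite -polyC_natr pchar_Fp_0 // oppr0.
Qed.

Lemma int_poly_mod_eq0 (c : {poly int}) :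
  map_poly intr c = 0 :> {poly 'F_p} -> exists d, c = p%:R * d.
Proof.
move=> /polyP c0; exists (\poly_(i < size c) (c`_i %/ p)%Z).
apply/polyP => i; rewrite -polyC_natr coefCM coef_poly.
case: ltnP => [_|ci]; last by rewrite mulr0 nth_default.
have := c0 i; rewrite coef_map coef0 => /eqP; rewrite intr_Fp_eq0 => /divzK.
by rewrite mulrC natz.
Qed.

Lemma ZXY_split (g : ZXY) : exists h : ZXY, g = varY * h + (g.[0])%:P.
Proof.
elim/poly_ind: g => [|g c _].
  by exists 0; rewrite mulr0 horner0 polyC0 addr0.
by exists g; rewrite hornerMXaddC mulr0 add0r [varY * g]mulrC.
Qed.

Lemma red_eq0 o g : red o g = 0 -> exists x y, g = var o * x + XYp * y.
Proof.
have [h gE] := ZXY_split (flip o g).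
move=> /int_poly_mod_eq0[d g0].
(* The remainder [p d] is rewritten through [p = XY - XYp]. *)
exists (flip o (h + varX * d%:P)), (flip o (- d%:P)).
rewrite -flip_varY -[in XYp * _](flip_XYp o) -!rmorphM -rmorphD.
rewrite -[g in LHS](flipK o).
congr (flip o _); rewrite gE g0 polyCM polyC_natr /XYp; ring.
Qed.

Lemma red_surj o q : exists g, red o g = q.
Proof.
exists (flip o (map_poly (fun x : 'F_p => (x : nat)%:Z) q)%:P).
rewrite /red flipK hornerC; apply/polyP => i.
by rewrite coef_map coef_map_id0 // /= -pmulrn natr_Zp.
Qed.

Lemma var_neq0 o : var o <> 0.
Proof.
by move=> v0; have := red_other (~~ o); rewrite negbK v0 rmorph0 => /esym/eqP;
  rewrite polyX_eq0.
Qed.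

Lemma XYp00 : XYp.[0].[0] = - p%:Z.
Proof.
rewrite /XYp hornerD hornerN hornerM hornerX mulr0 add0r -polyC_natr hornerC.
by rewrite hornerN -polyC_natr hornerC natz.
Qed.

Lemma XYp_neq0 : XYp <> 0.
Proof.
move=> f0; have := XYp00; rewrite f0 !horner0 => /esym/eqP.
by rewrite oppr_eq0 => /eqP[p0]; have := p_pr; rewrite p0.
Qed.

(** Modulo [var o], [XYp] is the nonzero constant [-p] in a domain. *)
Lemma var_XYp_cancel o b c : XYp * b = var o * c -> exists d, b = var o * d.
Proof.
move=> bc; have [h bE] := ZXY_split (flip o b).
suff b0 : (flip o b).[0] = 0.
  exists (flip o h); rewrite -flip_varY -rmorphM -[LHS](flipK o) bE b0 polyC0.
  by rewrite addr0.
have /(congr1 (fun g => (flip o g).[0])) := bc.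
rewrite !rmorphM flip_XYp -flip_varY flipK !hornerM hornerX mul0r.
rewrite /XYp hornerD hornerN hornerM hornerX mulr0 add0r -polyC_natr hornerC.
rewrite -polyC_natr mulNr => /eqP; rewrite oppr_eq0 mulf_eq0 polyC_eq0 natz.
by case/orP=> /eqP // -[p0]; have := p_pr; rewrite p0.
Qed.

(** [XYp] is linear in the outer variable with leading coefficient [X]; this amounts to substituting
    [Y = p/X] and clearing denominators. *)
Lemma XYp_pseudo_div (g : ZXY) : exists n q (r : {poly int}),
  varX ^+ n * g = XYp * q + r%:P.
Proof.
elim/poly_ind: g => [|g c [n [q [r IHg]]]].
  by exists 0%N, 0, 0; rewrite !mulr0 polyC0 addr0.
exists n.+1, (varX * varY * q + r%:P), (r * p%:R + 'X ^+ n.+1 * c).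
have -> : varX ^+ n.+1 * (g * 'X + c%:P) =
    varX * varY * (varX ^+ n * g) + varX ^+ n.+1 * c%:P.
  by rewrite /varY exprS; ring.
rewrite IHg polyCD !polyCM polyC_natr polyC_exp -/varX /XYp; ring.
Qed.

Lemma varX_power_cancel n g q :
  varX ^+ n * g = XYp * q -> exists d, g = XYp * d.
Proof.
elim: n q => [|n IHn] q; first by rewrite mul1r => ->; exists q.
rewrite exprS -mulrA => /[dup] gq /esym/(@var_XYp_cancel true)[d qE].
apply: (IHn d); apply: (domain_mulrI ZXY_domain (var_neq0 (o := true))).
by rewrite [LHS]gq qE mulrCA.
Qed.

(** The product of the two pseudo-remainders is free of [Y] and a multiple of [XYp], which has
    degree one in [Y]; so one remainder is zero, and the powers of [X] cancel. *)
Lemma XYp_prime x y c : x * y = XYp * c ->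
  (exists d, x = XYp * d) \/ (exists d, y = XYp * d).
Proof.
move=> xy; have [m [q [r xE]]] := XYp_pseudo_div x.
have [n [q' [r' yE]]] := XYp_pseudo_div y.
pose e : {poly {poly int}} :=
  varX ^+ (m + n) * c - q * (XYp * q' + r'%:P) - r%:P * q'.
have rr' : (r * r')%:P = XYp * e.
  have : (varX ^+ m * x) * (varX ^+ n * y) = varX ^+ (m + n) * (XYp * c).
    by rewrite -xy exprD; ring.
  by rewrite xE yE polyCM /e => H; rewrite mulrBr mulrBr mulrCA -H; ring.
have sf : size (XYp : {poly {poly int}}) = 2%N.
  rewrite /XYp /varX /varY -(polyC_natr _ p) -polyCN size_MXaddC size_polyC.
  by rewrite polyC_eq0 polyX_eq0.
have e0 : e = 0.
  apply/eqP; apply: contraT => e0.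
  have := congr1 (fun g : {poly {poly int}} => size g) rr'.
  rewrite size_mul // ?sf; last by rewrite -size_poly_eq0 sf.
  rewrite size_polyC addSn add1n /= => /eqP; rewrite eqn_leq => /andP[_].
  move: e0; rewrite -size_poly_eq0 -lt0n => e0 /leq_trans/(_ (leq_b1 _)).
  by rewrite ltnS leqNgt e0.
move: rr'; rewrite e0 mulr0 => /eqP; rewrite polyC_eq0 mulf_eq0.
case/orP=> /eqP r0; [left | right].
  by apply: (@varX_power_cancel m x q); rewrite xE r0 polyC0 addr0.
by apply: (@varX_power_cancel n y q'); rewrite yE r0 polyC0 addr0.
Qed.

End Plane.

(** * Divisibility in the local ring [T] *)

Section RamifiedRing.
Variable p : nat.
Hypothesis p_pr : prime p.
Local Notation T := (ramified_ring p_pr).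
Local Notation loc := (to_ramified_ring p_pr).
Local Notation XYp := (XYp p).

Lemma ramified_frac (t : T) :
  exists s g, ~~ (p %| s.[0].[0])%Z /\ t * loc s = loc g.
Proof.
have [a [s [sP tE]]] := localization_surj t.
have [g aE] := to_XYp_quot_surj a; have [s' sE] := to_XYp_quot_surj s.
exists s', g; split; last by rewrite /to_ramified_ring -sE -aE.
by rewrite -originP -sE.
Qed.

Lemma ramified_unit s : ~~ (p %| s.[0].[0])%Z -> exists u : T, u * loc s = 1.
Proof.
by rewrite -originP; apply: (@localization_unit _ (origin_prime p_pr)).
Qed.

(** [XYp] is prime and, having constant term [-p], divides no denominator, so localizing adds no
    relation. *)
Lemma ramified_eq g h : loc g = loc h <-> exists k, g - h = XYp * k.
Proof.
split=> [/eqP|[k ghE]]; last first.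
  suff gh : to_XYp_quot p g = to_XYp_quot p h by rewrite /to_ramified_ring gh.
  by apply/to_XYp_quot_eq; exists k; rewrite ghE mulrC.
rewrite -subr_eq0 -rmorphB => /eqP/localization_eq0[s sP].
have [s' sE] := to_XYp_quot_surj s; rewrite sE -rmorphM.
rewrite -(rmorph0 (to_XYp_quot p)) => /to_XYp_quot_eq[k].
rewrite subr0 [k * _]mulrC => /(XYp_prime p_pr)[[d s'E]|//].
move: sP; rewrite sE [_ \in _]originP s'E !hornerM XYp00.
by rewrite mulNr rpredN dvdz_mulr.
Qed.

Lemma ramified_eq0 g : loc g = 0 <-> exists k, g = XYp * k.
Proof. by rewrite -(rmorph0 loc) ramified_eq subr0. Qed.

Lemma ramified_domain (t t' : T) : t * t' = 0 -> t = 0 \/ t' = 0.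
Proof.
have [s [g [/ramified_unit[u us] tE]]] := ramified_frac t.
have [s' [g' [/ramified_unit[u' us'] tE']]] := ramified_frac t'.
have {us}tg : t = u * loc g by rewrite -tE mulrCA us mulr1.
have {us'}tg' : t' = u' * loc g' by rewrite -tE' mulrCA us' mulr1.
move=> tt; have : loc (g * g') = 0.
  by rewrite rmorphM /= -tE -tE' mulrACA tt mul0r.
move=> /ramified_eq0[k /(XYp_prime p_pr)[]] /ramified_eq0 g0.
  by left; rewrite tg g0 mulr0.
by right; rewrite tg' g0 mulr0.
Qed.

(** Membership in one of the two minimal primes over [p]. *)
Definition divisible o (t : T) : Prop := exists t', t = loc (var o) * t'.

(** Denominators can be cleared because [red] takes values in a domain and does not kill them. *)
Lemma divisible_loc o g : divisible o (loc g) <-> red p o g = 0.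
Proof.
split=> [[t gE]|/(red_eq0 p_pr)[x [y ->]]]; last first.
  exists (loc x); rewrite -rmorphM; apply/ramified_eq; exists y.
  by rewrite addrC addKr.
have [s [k [s0 tE]]] := ramified_frac t.
have /ramified_eq[c cE] : loc (g * s) = loc (var o * k).
  by rewrite !rmorphM /= gE -mulrA tE.
have /eqP : red p o (g * s) = 0.
  rewrite -[g * s](subrK (var o * k)) cE rmorphD !rmorphM /= red_var.
  by rewrite red_XYp // !mul0r addr0.
rewrite rmorphM mulf_eq0 => /orP[/eqP//|/eqP] /= s1.
by move: s0; rewrite -(red_eq0_at0 p_pr o) s1 horner0 eqxx.
Qed.

Lemma divisible_frac o t s g :
  ~~ (p %| s.[0].[0])%Z -> t * loc s = loc g -> divisible o t <-> red p o g = 0.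
Proof.
move=> /ramified_unit[u us] tE; rewrite -divisible_loc -tE.
split=> [[t' ->]|[t' tE']]; first by exists (t' * loc s); rewrite mulrA.
by exists (u * t'); rewrite mulrCA -tE' mulrCA us mulr1.
Qed.

Lemma divisible_mul o t t' :
  divisible o (t * t') -> divisible o t \/ divisible o t'.
Proof.
have [s [g [s0 tE]]] := ramified_frac t.
have [s' [g' [s0' tE']]] := ramified_frac t'.
have ss0 : ~~ (p %| (s * s').[0].[0])%Z.
  by rewrite !hornerM dvdzE abszM Euclid_dvdM // -!dvdzE negb_or s0.
have ttE : t * t' * loc (s * s') = loc (g * g').
  by rewrite !rmorphM /= -tE -tE' mulrACA.
rewrite (divisible_frac o ss0 ttE) rmorphM => /eqP; rewrite mulf_eq0.
by case/orP=> /eqP; [move/(divisible_frac o s0 tE); left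
                    |move/(divisible_frac o s0' tE'); right].
Qed.

Lemma divisible_exp o t n : divisible o (t ^+ n.+1) -> divisible o t.
Proof. by elim: n => // n IHn; rewrite exprS => /divisible_mul[]. Qed.

Lemma divisible_mulr o t t' : divisible o t -> divisible o (t' * t).
Proof. by move=> [c ->]; exists (t' * c); rewrite mulrCA. Qed.

Lemma divisible_other o : ~ divisible o (loc (var (~~ o))).
Proof. by rewrite divisible_loc red_other => /eqP; rewrite polyX_eq0. Qed.

Lemma ramified_p o : p%:R = loc (var o) * loc (var (~~ o)).
Proof.
rewrite -rmorphM -(rmorph_nat loc); apply/esym/ramified_eq; exists 1.
by rewrite mulr1 -XYpE.
Qed.

(** [X] lies outside the prime [YT], so [XT] and [YT] intersect in [XYT = pT]. *)
Lemma divisible_both (t : T) :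
  divisible true t -> divisible false t -> exists c, t = p%:R * c.
Proof.
move=> [c ->] /divisible_mul[/(@divisible_other false)//|[d ->]].
by exists d; rewrite mulrA -(ramified_p true).
Qed.

Lemma divisible_p o (c : T) : divisible o (p%:R * c).
Proof. by exists (loc (var (~~ o)) * c); rewrite mulrA -ramified_p. Qed.

Lemma ramified_local (t : T) : (exists u, u * t = 1) \/
  exists x y, t = loc varX * x + loc varY * y.
Proof.
have [s [g [/ramified_unit[u us] tE]]] := ramified_frac t.
have tg : t = u * loc g by rewrite -tE mulrCA us mulr1.
case: (boolP (p %| g.[0].[0])%Z) => [/dvdzP[c g0]|/ramified_unit[v vg]];
  last first.
  by left; exists (v * loc s); rewrite -mulrA [loc s * t]mulrC tE.
(* The reduction modulo [(X, p)] is a polynomial in [Y] without constant term; lifting its quotient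
   by [Y] leaves a multiple of [X]. *)
right; have [q qE] : exists q, red p true g = q * ('X - 0%:P).
  by apply/factor_theorem/eqP/eqP; rewrite red_eq0_at0 // g0 dvdz_mull.
have [k kE] := red_surj true q.
have /divisible_loc[y yE] : red p true (g - k * varY) = 0.
  rewrite rmorphB rmorphM /= (red_other p true) kE qE subr0; exact: subrr.
exists (u * y), (u * loc k).
rewrite mulrCA -yE tg rmorphB rmorphM; ring.
Qed.

(* [T/(a)] is a discrete valuation ring with uniformizer the other variable. *)
Lemma power_other o (h : T) : ~ divisible o h ->
  exists n x y, loc (var (~~ o)) ^+ n = h * x + loc (var o) * y.
Proof.
have [s [g [s0 tE]]] := ramified_frac h; rewrite (divisible_frac o s0 tE) => g0.
(* [n] is the valuation of [h]; the cofactor does not vanish at 0, so its lift is a unit of [T]. *)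
have [n [q qn gE]] := multiplicity_XsubC (red p o g) 0.
have {qn}q0 : ~~ root q 0 by move: qn; rewrite (introN eqP g0).
have [k kE] := red_surj o q.
have /ramified_unit[u uk] : ~~ (p %| k.[0].[0])%Z.
  by rewrite -(red_eq0_at0 p_pr o) kE.
have /divisible_loc[y yE] : red p o (g - k * var (~~ o) ^+ n) = 0.
  rewrite rmorphB rmorphM rmorphXn /= red_other kE gE subr0; exact: subrr.
exists n, (u * loc s), (- (u * y)).
rewrite mulrN [h * _]mulrCA tE [loc (var o) * _]mulrCA -yE -mulrBr -rmorphB.
by rewrite opprB addrC subrK rmorphM rmorphXn mulrA uk mul1r.
Qed.

Lemma power_other_mod_p o (h : T) m : ~ divisible o h ->
  exists n x y, loc (var (~~ o)) ^+ n = h ^+ m * x + p%:R * y.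
Proof.
move=> ho; have [|n [x [y nE]]] := @power_other o (h ^+ m).
  case: m => [|m]; last by move=> /divisible_exp.
  move=> /(divisible_mulr (loc (var (~~ o)))).
  by rewrite mulr1; apply: divisible_other.
(* One more factor of the other variable turns the multiple of [var o] into one of [p]. *)
exists n.+1, (loc (var (~~ o)) * x), y.
by rewrite exprS nE (ramified_p o); ring.
Qed.

(** * Ideals of [T] modulo [p] *)

Section Ideal.
Variable J : set T.
Hypothesis J_ideal : is_ideal J.

Lemma ideal_exp_divisible o : (forall t, J t -> divisible o t) ->
  forall n t, ideal_exp J n t -> exists c, t = loc (var o) ^+ n * c.
Proof.
move=> Jo; apply: (@ideal_exp_sub _ _ (fun n =>
  [set t | exists c, t = loc (var o) ^+ n * c])).
- move=> n; split=> [|t t' /= [c ->] [c' ->]|a t /= [c ->]] /=.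
  + by exists 0; rewrite mulr0.
  + by exists (c + c'); rewrite mulrDr.
  + by exists (a * c); rewrite mulrCA.
- by exists 1; rewrite mulr1.
move=> n a b /Jo[a' ->] /= [b' ->].
by exists (a' * b'); rewrite exprS mulrACA.
Qed.

(** Mixed monomials are multiples of [p = XY], so only pure powers remain; exponent 0 is treated
    apart, as its cross terms are not mixed. *)
Lemma ideal_exp_maximal :
  (forall t, J t -> exists x y, t = loc varX * x + loc varY * y) ->
  forall n t, ideal_exp J n t ->
  exists x y z, t = loc varX ^+ n * x + loc varY ^+ n * y + p%:R * z.
Proof.
move=> Jm; apply: (@ideal_exp_sub _ _ (fun n => [set t | exists x y z,
  t = loc varX ^+ n * x + loc varY ^+ n * y + p%:R * z])).
- move=> n; split=> [|t t' /= [x [y [z ->]]] [x' [y' [z' ->]]]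
      |a t /= [x [y [z ->]]]] /=.
  + by exists 0, 0, 0; rewrite !mulr0 !addr0.
  + by exists (x + x'), (y + y'), (z + z'); ring.
  + by exists (a * x), (a * y), (a * z); ring.
- by exists 1, 0, 0; ring.
move=> [|n] a b /Jm[x [y ->]] /= [x' [y' [z' ->]]].
  by exists (x * (x' + y' + p%:R * z')), (y * (x' + y' + p%:R * z')), 0; ring.
exists (x * x'), (y * y'), ((loc varX * x + loc varY * y) * z' +
  x * loc varY ^+ n * y' + y * loc varX ^+ n * x').
rewrite (ramified_p true) !exprS; ring.
Qed.

(** Prime avoidance: if [h1] and [h2] each avoid one prime and lie in the other, their sum avoids
    both. *)
Lemma ideal_avoidance : (exists o, forall t, J t -> divisible o t) \/
  (exists2 h, J h & forall o, ~ divisible o h).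
Proof.
have [_ JD _] := J_ideal.
have dec o : (forall t, J t -> divisible o t) \/
    (exists2 t, J t & ~ divisible o t).
  have [?|Jo] := pselect (exists2 t, J t & ~ divisible o t); first by right.
  by left=> t Jt; have [//|to] := pselect (divisible o t); case: Jo; exists t.
case: (dec true) => [JX|[h1 Jh1 h1X]]; first by left; exists true.
case: (dec false) => [JY|[h2 Jh2 h2Y]]; first by left; exists false.
right; have [h1Y|] := pselect (divisible false h1); last by exists h1 => // -[].
have [h2X|] := pselect (divisible true h2); last by exists h2 => // -[].
exists (h1 + h2) => [|[] [c cE]]; first exact: JD.
  apply: h1X; case: h2X cE => d -> cE; exists (c - d).
  by rewrite mulrBr -cE addrK.
apply: h2Y; case: h1Y cE => d -> cE; exists (c - d).
by rewrite mulrBr -cE addrC addKr.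
Qed.

(* Up to radical, the image of [J] in [T/pT] is principal. *)
Lemma ideal_mod_p_principal : (exists2 t, J t & t <> 0) ->
  exists h : T, [/\ J h, h <> 0 &
  forall m, exists n, forall a, ideal_exp J n a ->
    exists b c, a = b * h ^+ m + c * p%:R].
Proof.
move=> [t0 Jt0 t00].
have nz o h : ~ divisible o h -> h <> 0.
  by move=> ho h0; apply: ho; exists 0; rewrite h0 mulr0.
have [[o Jo]|[h Jh ho]] := ideal_avoidance.
  (* If [J] lies in both primes, it lies in [pT] and any nonzero element serves. *)
  have [Jo'|] := pselect (forall t, J t -> divisible (~~ o) t).
    exists t0; split=> // m; exists 1%N => a.
    move=> /[dup]/(ideal_exp_divisible Jo) ao /(ideal_exp_divisible Jo') ao'.
    have [c ->] : exists c, a = p%:R * c.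
      by case: (o) ao ao' => aX aY; apply: divisible_both.
    by exists 0, c; rewrite mul0r add0r mulrC.
  move=> /existsNP[h /not_implyP[Jh ho]].
  exists h; split=> //; first exact: nz ho.
  (* Here [h] avoids the other prime, so a power of [var o] lies in the ideal of [h ^+ m] and
     [p]. *)
  move=> m; have [n [x [y nE]]] := power_other_mod_p m ho.
  rewrite negbK in nE; exists n => a /(ideal_exp_divisible Jo)[c ->].
  by exists (x * c), (y * c); rewrite nE; ring.
have [[t Jt [u ut]]|Jm] := pselect (exists2 t, J t & exists u, u * t = 1).
  exists t; split=> [//|t0E|m].
    by move/eqP: ut; rewrite t0E mulr0 eq_sym oner_eq0.
  exists 0%N => a _; exists (a * u ^+ m), 0.
  by rewrite mul0r addr0 -mulrA -exprMn ut expr1n mulr1.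
exists h; split=> //; first exact: nz (ho true).
move=> m; have [n [x [y nE]]] := power_other_mod_p m (ho true).
have [n' [x' [y' nE']]] := power_other_mod_p m (ho false).
(* [J] is proper, hence in the maximal ideal, and [h] avoids both primes, so the ideal of [h ^+ m]
   and [p] contains powers of both variables. *)
exists (n + n')%N => a /ideal_exp_maximal[|z [z' [z'' ->]]].
  move=> t Jt; have [[u ut]|//] := ramified_local t.
  by case: Jm; exists t; [exact: Jt | exists u].
move: nE nE' => /= nE nE'.
exists (loc varX ^+ n * x' * z + loc varY ^+ n' * x * z').
exists (loc varX ^+ n * y' * z + loc varY ^+ n' * y * z' + z'').
rewrite [loc varY ^+ (_ + _)]exprD exprD nE nE'; ring.
Qed.

Lemma extension_contraction : extension loc (contraction loc J) = J.
Proof.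
have [_ _ JM] := J_ideal; apply/seteqP; split=> [t|t Jt].
  by apply=> // _ [g Jg <-].
have [s [g [/ramified_unit[u us] tE]]] := ramified_frac t.
have -> : t = u * loc g by rewrite -tE mulrCA us mulr1.
have [_ _ SM] := ideal_spanP (loc @` contraction loc J).
apply: SM; apply: sub_ideal_span; exists g => //.
by rewrite /contraction /= -tE mulrC; apply: JM.
Qed.

End Ideal.

Lemma ramified_p_neq0 : p%:R <> 0 :> T.
Proof.
have v0 o : loc (var o) <> 0.
  by move=> v0; apply: (@divisible_other (~~ o)); rewrite negbK; exists 0;
    rewrite v0 mulr0.
by rewrite (ramified_p true) => /ramified_domain[]; apply: v0.
Qed.

Lemma divisible_p_both (t : T) :
  (forall o, divisible o t) -> exists c, t = p%:R * c.
Proof. by move=> to; apply: divisible_both. Qed.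

(* [T/pT] is reduced. *)
Lemma p_divides_power (h a b : T) m :
  a * p%:R = h ^+ m.+1 * b -> exists c, a = c * h ^+ m.
Proof.
move=> ab; have [o|c hb] := @divisible_p_both (h * b).
  have /divisible_mul[/divisible_exp ho|] : divisible o (h ^+ m.+1 * b).
    by rewrite -ab mulrC; apply: divisible_p.
    by rewrite mulrC; apply: divisible_mulr.
  exact: divisible_mulr.
exists c; apply: (domain_mulrI ramified_domain ramified_p_neq0).
by rewrite mulrC ab exprSr -mulrA hb; ring.
Qed.

Local Notation N := (quotmod (principal (p%:R : T))).

Lemma p_annihilates (n : N) : (p%:R : T) *: n = 0.
Proof.
have [t ->] := to_quotmod_surj n; rewrite -[LHS]to_quotmodZ.
by apply/to_principal_eq0; exists t.
Qed.

Lemma nonzerodivisor_mod_p (h : T) : (forall o, ~ divisible o h) ->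
  forall n : N, h *: n = 0 -> n = 0.
Proof.
move=> ho n; have [t ->] := to_quotmod_surj n.
rewrite -[h *: _]to_quotmodZ => /to_principal_eq0[c hc].
apply/to_principal_eq0; apply: divisible_p_both => o.
have /divisible_mul[/ho//|//] : divisible o (h * t).
by rewrite [h * t]hc; apply: divisible_p.
Qed.

Lemma associated_contraction (J : set T) o (ER : injective_resolution ZXY^o) :
  is_ideal J -> (forall t, J t -> divisible o t) -> (exists2 t, J t & t <> 0) ->
  Z_associated (local_cohomology (contraction loc J) ER 2) p.
Proof.
move=> [J0 _ JM] Jo [t Jt t0].
(* The numerator of a nonzero element of [J] lies in the contraction and is no multiple of [XYp]. *)
have [s [g [/ramified_unit[u us] tE]]] := ramified_frac t.
have g0 : loc g <> 0.
  by move=> g0; apply: t0; rewrite -[t]mulr1 -us mulrCA tE g0 mulr0.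
apply: (@associated_local_cohomology2 _ ER _ (var o) XYp g p p_pr).
- exact: ZXY_domain.
- exact: var_neq0.
- exact: XYp_neq0.
- by move=> b c; apply: var_XYp_cancel.
- exact: XYp_prime.
- have f0 : loc XYp = 0 by apply/ramified_eq0; exists 1; rewrite mulr1.
  by rewrite /contraction /= f0.
- by rewrite /contraction /= -tE mulrC; apply: JM.
- by move=> /ramified_eq0.
- by move=> x /Jo/divisible_loc/(red_eq0 p_pr).
- move=> [b [c /(congr1 (red p o))]].
  rewrite rmorph1 rmorphD !rmorphM /= red_var (red_XYp p_pr) !mul0r addr0.
  by move/eqP; rewrite oner_eq0.
by exists (var (~~ o)), (- 1); rewrite (XYpE p o); ring.
Qed.

End RamifiedRing.

Theorem theorem5p1 (p : nat) (p_pr : prime p)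
    (J : set (ramified_ring p_pr)) (J_ideal : is_ideal J) (i : nat)
    (ER : injective_resolution ZXY^o) :
  let I := contraction (to_ramified_ring p_pr) J in
  ~ Z_associated (local_cohomology I ER i) p ->
  ~ Z_associated (local_cohomology I ER i.+1) p ->
  forall (B : bockstein_data (p%:R : ramified_ring p_pr))
    (x : local_cohomology_pred (extension (to_ramified_ring p_pr) I)
           (bock_quo B) i),
    bockstein B (extension (to_ramified_ring p_pr) I) i x = 0.
Proof.
move=> I _; rewrite /I extension_contraction // => H2 B.
have regular (h : ramified_ring p_pr) : h <> 0 -> forall a, a * h = 0 -> a = 0.
  by move=> h0 a /ramified_domain[].
(* In degree 0 the map is zero by definition. In degree 1 the target vanishes if [J] is zero;
   otherwise the hypothesis on the second local cohomology leaves only the case where the source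
   vanishes. *)
case: i H2 => [//|[|i]] H2 x /=.
  have [Jnz|Jz] := pselect (exists2 t, J t & t <> 0); last first.
    apply: local_cohomology0 => t Jt.
    by have [//|t0] := pselect (t = 0); case: Jz; exists t.
  have [[o Jo]|[h Jh ho]] := ideal_avoidance J_ideal.
    by case: H2; apply: associated_contraction Jo Jnz.
  have -> : x = 0.
    exact: (local_cohomology_depth Jh (nonzerodivisor_mod_p ho)).
  exact: bockstein_eq0.
(* From degree 2 on, the target vanishes. *)
have [Jnz|Jz] := pselect (exists2 t, J t & t <> 0); last first.
  apply: local_cohomology0 => t Jt.
  by have [//|t0] := pselect (t = 0); case: Jz; exists t.
have [h [Jh h0 hJ]] := ideal_mod_p_principal J_ideal Jnz.
apply: (local_cohomology_vanish (@p_annihilates p p_pr) Jh (regular _ h0)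
  _ hJ).
by move=> a b m; apply: p_divides_power.
Qed.
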